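(* Let $\mathcal{P}_h\subset\mathbb{C}\mathbb{F}_n^+$ be a set of homogeneous polynomials and let $B_1,\ldots,B_n$ be the operators on $\mathcal{N}_J$ associated with $\mathcal{P}_h$. A map $\mu:C^*(B_1,\ldots,B_n)\to B(\mathcal{H})$ is a Poisson transform if and only if there is a row contraction $[T_1,\ldots,T_n]$, $T_i\in B(\mathcal{H})$, with $p(T_1,\ldots,T_n)=0$ for any homogeneous polynomial $p\in\mathcal{P}_h$, such that $$\mu(B_\alpha B_\beta^* )=T_\alpha T_\beta^*,\qquad \alpha,\beta\in\mathbb{F}_n^+.$$
   Context: Let $n\in\{1,2,\ldots\}$ or $n=\infty$, and let $\mathcal{H}$ be a Hilbert space. $\mathbb{F}_n^+$ is the free semigroup with generators $g_1,\ldots,g_n$ and neutral element $g_0$; $|\alpha|$ is the length of $\alpha$; $\mathbb{C}\mathbb{F}_n^+$ is the complex free semigroup algebra. For operators $T_1,\ldots,T_n$, $T_\alpha:=T_{i_1}\cdots T_{i_k}$ if $\alpha=g_{i_1}\cdots g_{i_k}$, $T_{g_0}:=I$, and for $p=\sum a_\alpha\alpha\in\mathbb{C}\mathbb{F}_n^+$, $p(T_1,\ldots,T_n):=\sum a_\alpha T_\alpha$. $[T_1,\ldots,T_n]$ is a row contraction if $\sum_iT_iT_i^*\le I$. A polynomial $p=\sum_{j=1}^m a_j\alpha_j$, $a_j\ne0$, is homogeneous if $|\alpha_j|=|\alpha_1|$ for all $j$. $F^2(H_n)=\bigoplus_{k\ge0}H_n^{\otimes k}$ is the full Fock space of an $n$-dimensional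 Hilbert space $H_n$ with orthonormal basis $e_1,\ldots,e_n$, $S_i\psi=e_i\otimes\psi$ are the left creation operators, and $F_n^\infty$ is the weakly closed algebra generated by $S_1,\ldots,S_n$ and the identity. Given $\mathcal{P}_h$, let $J$ be the WOT-closed two-sided ideal of $F_n^\infty$ generated by $\{p(S_1,\ldots,S_n):p\in\mathcal{P}_h\}$, $\mathcal{N}_J:=F^2(H_n)\ominus JF^2(H_n)$, and $B_i:=P_{\mathcal{N}_J}S_i|_{\mathcal{N}_J}$, $i=1,\ldots,n$. $C^*(B_1,\ldots,B_n)$ (resp. $\mathcal{A}_n$) is the $C^*$-algebra (resp. non-selfadjoint norm-closed algebra) generated by $B_1,\ldots,B_n$ and the identity. A Poisson transform on $C^*(B_1,\ldots,B_n)$ is a unital completely positive linear map $\mu:C^*(B_1,\ldots,B_n)\to B(\mathcal{H})$ such that $\mu(AX)=\mu(A)\mu(X)$ for all $A\in\mathcal{A}_n$ and $X\in\mathcal{A}_n\mathcal{A}_n^*$.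
   Formalization: In the ''if'' direction the map μ is assumed unital completely positive linear (for an arbitrary map it is false); it is proved in addition that every row contraction annihilated by P_h comes from some Poisson transform. *)

(* Defs.v *)
From HB Require Import structures.
From mathcomp Require Import all_boot all_order all_algebra finmap.
From mathcomp Require Import all_classical all_reals all_analysis.
From mathcomp Require Import complex.
From mathcomp Require Import ring lra.

Set Implicit Arguments.
Unset Strict Implicit.
Unset Printing Implicit Defensive.
Import Order.TTheory GRing.Theory Num.Theory numFieldNormedType.Exports.
Local Open Scope classical_set_scope.
Local Open Scope ring_scope.
Local Open Scope complex_scope.

HB.mixin Record isHilbert (R : realType) H & CompleteNormedModule R[i] H := {
  inner : H -> H -> R[i];
  inner_linear : forall y, scalar (inner^~ y);
  inner_conj : forall x y, inner y x = (inner x y)^*%C;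
  inner_norm : forall x, inner x x = `|x| ^+ 2 }.

#[short(type="hilbertType")]
HB.structure Definition Hilbert (R : realType) :=
  {H of isHilbert R H & CompleteNormedModule R[i] H}.

Section PreHilbert.
Context (R : realType) (V : lmodType R[i]) (f : V -> V -> R[i]).
Hypothesis f_linear : forall y, scalar (f^~ y).
Hypothesis f_conj : forall x y, f y x = (f x y)^*%C.
Hypothesis f_ge0 : forall x, 0 <= f x x.
Hypothesis f_eq0 : forall x, f x x = 0 -> x = 0.

Let N x := sqrtC (f x x).

Lemma form_Dl x y z : f (x + y) z = f x z + f y z.
Proof. by have := f_linear z 1 x y; rewrite scale1r mul1r. Qed.

Lemma form_0l z : f 0 z = 0.
Proof. by have := form_Dl 0 0 z; rewrite addr0 -{1}[f 0 z]addr0 => /addrI. Qed.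

Lemma form_Zl a x z : f (a *: x) z = a * f x z.
Proof. by have := f_linear z a x 0; rewrite !addr0 form_0l addr0. Qed.

Lemma form_Dr x y z : f z (x + y) = f z x + f z y.
Proof. by rewrite f_conj form_Dl raddfD /= -!f_conj. Qed.

Lemma form_Zr a x z : f z (a *: x) = a^*%C * f z x.
Proof. by rewrite f_conj form_Zl rmorphM /= -f_conj. Qed.

Lemma mulCJ (c : R[i]) : c * c^*%C = `|c| ^+ 2.
Proof. exact: esym (normCK c). Qed.

Lemma form_CauchySchwarz x y : `|f x y| ^+ 2 <= f x x * f y y.
Proof.
have [b0|bN0] := eqVneq (f y y) 0.
  have -> : f x y = 0 by rewrite (f_eq0 b0) f_conj form_0l rmorph0.
  by rewrite normr0 expr0n/= mulr_ge0.
have bgt0 : 0 < f y y by rewrite lt_def bN0 f_ge0.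
have := f_ge0 (f y y *: x + (- f x y) *: y).
have Bj : (f y y)^*%C = f y y by rewrite -f_conj.
rewrite !(form_Dl, form_Dr, form_Zl, form_Zr) Bj rmorphN /= (f_conj x y).
rewrite [X in 0 <= X](_ : _ = f y y * (f x x * f y y - f x y * (f x y)^*%C)).
  by rewrite pmulr_rge0// subr_ge0 mulCJ.
by ring.
Qed.

Lemma form_normD x y : N (x + y) <= N x + N y.
Proof.
rewrite /N -(ler_pXn2r (ltn0Sn 1)) ?nnegrE ?addr_ge0 ?sqrtC_ge0//.
rewrite [leRHS](_ : _ = f x x + f y y + 2%:R * (sqrtC (f x x) * sqrtC (f y y))).
  rewrite sqrtCK form_Dl !form_Dr (f_conj x y).
  rewrite [leLHS](_ : _ = f x x + f y y + (f x y + (f x y)^*%C)); last by ring.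
  rewrite addcJ lerD2l ler_pM2l ?ltr0n//.
  apply: (@le_trans _ _ `|f x y|).
    rewrite normc_def lecR (le_trans (ler_norm _))//.
    by rewrite -sqrtr_sqr ler_wsqrtr// lerDl sqr_ge0.
  rewrite -(ler_pXn2r (ltn0Sn 1)) ?nnegrE ?mulr_ge0 ?sqrtC_ge0//.
  by rewrite exprMn !sqrtCK form_CauchySchwarz.
by rewrite sqrrD !sqrtCK; ring.
Qed.

Lemma form_normZ (a : R[i]) x : N (a *: x) = `|a| * N x.
Proof.
rewrite /N form_Zl form_Zr mulrA mulCJ sqrtCM ?nnegrE ?exprn_ge0//.
by rewrite sqrCK.
Qed.

Lemma form_norm0_eq0 x : N x = 0 -> x = 0.
Proof. by move/eqP; rewrite sqrtC_eq0 => /eqP/f_eq0. Qed.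

End PreHilbert.

(* Completeness is asked for sequences, in terms of the form alone. *)
HB.factory Record Lmodule_isHilbert (R : realType) H & GRing.Lmodule R[i] H := {
  form : H -> H -> R[i];
  form_linear : forall y, scalar (form^~ y);
  form_conj : forall x y, form y x = (form x y)^*%C;
  form_ge0 : forall x, 0 <= form x x;
  form_eq0 : forall x, form x x = 0 -> x = 0;
  form_complete : forall u : nat -> H,
    (forall e : R, 0 < e -> exists N, forall m n, (N <= m)%N -> (N <= n)%N ->
       form (u m - u n) (u m - u n) <= (e ^+ 2)%:C) ->
    exists l, forall e : R, 0 < e -> exists N, forall n, (N <= n)%N ->
       form (u n - l) (u n - l) <= (e ^+ 2)%:C }.

HB.builders Context R H & Lmodule_isHilbert R H.

HB.instance Definition _ := @Lmodule_isNormed.Build R[i] H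
  (fun x => sqrtC (form x x))
  (form_normD form_linear form_conj form_ge0 form_eq0)
  (form_normZ form_linear form_conj form_ge0)
  (form_norm0_eq0 form_eq0).

Lemma form_norm (x : H) : form x x = `|x| ^+ 2.
Proof. by rewrite -{1}[form x x]sqrtCK. Qed.

Lemma form_norm_le (x : H) (e : R) : 0 <= e ->
  (form x x <= (e ^+ 2)%:C) = (`|x| <= e%:C).
Proof.
by move=> e0; rewrite form_norm rmorphXn /= ler_pXn2r ?nnegrE ?ler0c.
Qed.

Lemma hilbert_cauchy (F : set_system H) : ProperFilter F -> cauchy F -> cvg F.
Proof.
move=> FF /cauchyP Fc.
have ek n : 0 < (n.+1%:R^-1 : R)%:C by rewrite ltcR invr_gt0.
have [u uF] := choice (fun n => Fc _ (ek n)).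
have uuE m n : `|u m - u n| < (m.+1%:R^-1 : R)%:C + (n.+1%:R^-1)%:C.
  have [z [/= zm zn]] := filter_ex (filterI (uF m) (uF n)).
  move: zm zn; rewrite -!ball_normE /= => zm zn.
  rewrite -(subrK z (u m)) -addrA; apply: le_lt_trans (ler_normD _ _) _.
  by rewrite ltrD// distrC.
have small (e : R) : 0 < e -> exists N, forall n, (N <= n)%N -> (n.+1%:R^-1 : R) <= e / 2.
  move=> e0; have e2 : 0 < e / 2 by rewrite divr_gt0.
  exists (Num.truncn (e / 2)^-1) => n Nn.
  rewrite -[leRHS]invrK lef_pV2 ?posrE ?invr_gt0//.
  apply: ltW; apply: lt_le_trans (truncnS_gt _) _.
  by rewrite ler_nat.
have [|l ul] := @form_complete u.
  move=> e e0; have [N HN] := small e e0; exists N => m n Nm Nn.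
  rewrite (form_norm_le _ (ltW e0)); apply: le_trans (ltW (uuE m n)) _.
  by rewrite -rmorphD /= lecR [leRHS]splitr lerD ?HN.
apply/cvg_ex; exists l; apply/fcvgrPdist_lt => e e0.
have /complex_realP[r er] : e \is Num.real by rewrite gtr0_real.
move: e0; rewrite er ltcR => r0.
have r2 : 0 < r / 2 by rewrite divr_gt0.
have [N1 HN1] := small r r0; have [N2 HN2] := ul _ r2.
set n := maxn N1 N2.
apply: filterS (uF n) => z; rewrite -ball_normE /= => zn.
rewrite -(subrK (u n) l) -addrA; apply: le_lt_trans (ler_normD _ _) _.
rewrite [X in _ < X%:C]splitr rmorphD /= ler_ltD//.
  by rewrite distrC -(form_norm_le _ (ltW r2)) HN2 ?leq_maxr.
apply: lt_le_trans zn _; rewrite lecR HN1 ?leq_maxl//.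
Qed.

HB.instance Definition _ := Uniform_isComplete.Build H hilbert_cauchy.
HB.instance Definition _ :=
  isHilbert.Build R H form_linear form_conj form_norm.

HB.end.

Section Inner.
Context (R : realType) (H : hilbertType R).
Implicit Types x y z : H.

Lemma inner_ge0 x : 0 <= inner x x.
Proof. by rewrite inner_norm exprn_ge0. Qed.

Lemma inner_eq0 x : inner x x = 0 -> x = 0.
Proof. by move/eqP; rewrite inner_norm expf_eq0/= normr_eq0 => /eqP. Qed.

Lemma CauchySchwarz x y : `|inner x y| <= `|x| * `|y|.
Proof.
rewrite -(ler_pXn2r (ltn0Sn 1)) ?nnegrE ?mulr_ge0// exprMn -!inner_norm.
exact: (form_CauchySchwarz inner_linear inner_conj inner_ge0 inner_eq0).
Qed.

End Inner.

(* The orthogonal complement of a set of vectors, as a Hilbert space. *)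
Section OrthogonalComplement.
Context (R : realType) (H : hilbertType R) (M : set H).

Definition perp_pred : {pred H} :=
  fun x => `[< forall y, M y -> inner x y = 0 >].

Record perp := Perp { perp_val : H; _ : perp_val \in perp_pred }.

HB.instance Definition _ := [isSub for perp_val].
HB.instance Definition _ := [Choice of perp by <:].

Lemma perpP x : reflect (forall y, M y -> inner x y = 0) (x \in perp_pred).
Proof. exact: asboolP. Qed.

Lemma perp_submod_closed : submod_closed perp_pred.
Proof.
split=> [|a x y /perpP xM /perpP yM]; apply/perpP => z Mz.
  by rewrite (form_0l inner_linear).
by rewrite inner_linear xM// yM// mulr0 addr0.
Qed.

HB.instance Definition _ :=
  GRing.isSubmodClosed.Build R[i] H perp_pred perp_submod_closed.
HB.instance Definition _ := [SubChoice_isSubLmodule of perp by <:].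

Let form (x y : perp) := inner (val x) (val y).

Let form_linear y : scalar (form^~ y).
Proof. by move=> a x z; rewrite /form linearP inner_linear. Qed.

Let form_conj x y : form y x = (form x y)^*%C.
Proof. exact: inner_conj. Qed.

Let form_ge0 x : 0 <= form x x.
Proof. exact: inner_ge0. Qed.

Let form_eq0 x : form x x = 0 -> x = 0.
Proof. by move/inner_eq0 => x0; apply: val_inj; rewrite x0 raddf0. Qed.

Let form_complete (u : nat -> perp) :
  (forall e : R, 0 < e -> exists N, forall m n, (N <= m)%N -> (N <= n)%N ->
     form (u m - u n) (u m - u n) <= (e ^+ 2)%:C) ->
  exists l, forall e : R, 0 < e -> exists N, forall n, (N <= n)%N ->
     form (u n - l) (u n - l) <= (e ^+ 2)%:C.
Proof.
have formE (x : H) (e : R) : 0 < e ->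
    (inner x x <= (e ^+ 2)%:C) = (`|x| <= e%:C).
  move=> e0.
  by rewrite inner_norm rmorphXn /= ler_pXn2r ?nnegrE ?ler0c ?(ltW e0).
have toR (e : R[i]) : 0 < e -> exists2 r : R, 0 < r & e = r%:C.
  move=> e0; have /complex_realP[r er] : e \is Num.real by rewrite gtr0_real.
  by exists r => //; move: e0; rewrite er ltcR.
move=> uC.
have /cauchy_cvgP/cvg_ex[/= l ul] : cauchy ((fun n => val (u n)) @ \oo).
  apply/cauchyP => e /toR[r r0 ->].
  have r2 : 0 < r / 2 by rewrite divr_gt0.
  have [N HN] := uC _ r2; exists (val (u N)).
  change (\forall n \near \oo, ball (val (u N)) r%:C (val (u n))); near=> n.
  rewrite -ball_normE /= -[_ - _]/(val (u N) - val (u n)) -raddfB.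
  apply: (@le_lt_trans _ _ (r / 2)%:C).
    rewrite -formE//; apply: HN => //; near: n; exact: nbhs_infty_ge.
  by rewrite ltcR ltr_pdivrMr// ltr_pMr// ltr1n.
have lM : l \in perp_pred.
  apply/perpP => y My; apply/eqP; rewrite -normr_eq0 eq_le normr_ge0 andbT.
  apply/ler_addgt0Pl => e e0; rewrite addr0.
  have y1 : 0 < `|y| + 1 by rewrite ltr_wpDl.
  have /cvgrPdist_lt/(_ _ (divr_gt0 e0 y1)) [N _ /(_ N (leqnn N)) /= HN] := ul.
  have -> : inner l y = inner (l - val (u N)) y.
    rewrite (form_Dl inner_linear) -scaleN1r (form_Zl inner_linear).
    by have /perpP -> := valP (u N) => //; rewrite mulr0 addr0.
  apply: le_trans (CauchySchwarz _ _) _.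
  apply: (@le_trans _ _ (e / (`|y| + 1) * `|y|)).
    by rewrite ler_wpM2r// ltW.
  by rewrite mulrAC ler_pdivrMr// ler_wpM2l ?ltW// ltrDl.
exists (Perp lM) => e e0.
have e0' : 0 < e%:C by rewrite ltcR.
have /cvgrPdist_lt/(_ _ e0') [N _ HN] := ul.
exists N => n /HN /= uln; rewrite /form formE// raddfB /= distrC.
exact: ltW.
Unshelve. all: by end_near. Qed.

HB.instance Definition _ := Lmodule_isHilbert.Build R perp
  form_linear form_conj form_ge0 form_eq0 form_complete.

End OrthogonalComplement.

Lemma inner_perpE (R : realType) (H : hilbertType R) (M : set H)
  (x y : perp M) : inner x y = inner (val x) (val y).
Proof. by []. Qed.

(* The Hilbert space of square-summable families indexed by [I]. *)
Section SquareSummable.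
Context (R : realType) (I : countType).

Definition sqmod (z : R[i]) : R := complex.Re z ^+ 2 + complex.Im z ^+ 2.

(* The sum of an absolutely convergent family, along the enumeration of [I]
   given by its countType structure. *)
Definition sum_term (F : I -> R) (k : nat) : R := oapp F 0 (pickle_inv k).
Definition sumR (F : I -> R) : R := limn (series (sum_term F)).
Definition sumC (F : I -> R[i]) : R[i] :=
  sumR (fun i => complex.Re (F i)) +i* sumR (fun i => complex.Im (F i)).

Definition l2_pred : {pred I -> R[i]} :=
  fun f => (\esum_(i in [set: I]) (sqmod (f i))%:E < +oo)%E.

Record l2 := L2 { l2_val :> I -> R[i]; _ : l2_val \in l2_pred }.

Lemma sqmod_ge0 z : 0 <= sqmod z.
Proof. by rewrite addr_ge0// sqr_ge0. Qed.

Lemma sqmodM (a z : R[i]) : sqmod (a * z) = sqmod a * sqmod z.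
Proof. by case: a z => a b [c d]; rewrite /sqmod /=; ring. Qed.

Lemma sqmodD (y z : R[i]) : sqmod (y + z) <= 2 * sqmod y + 2 * sqmod z.
Proof.
case: y z => a b [c d]; rewrite /sqmod /=.
have := sqr_ge0 (a - c); have := sqr_ge0 (b - d); nra.
Qed.

Lemma l2P (f : I -> R[i]) :
  f \in l2_pred <->
  exists M, forall s, uniq s -> \sum_(i <- s) sqmod (f i) <= M.
Proof.
rewrite unfold_in; split=> [fo|[M HM]].
  have f0 : (0 <= \esum_(i in [set: I]) (sqmod (f i))%:E)%E.
    by apply: esum_ge0 => i _; rewrite lee_fin sqmod_ge0.
  exists (fine (\esum_(i in [set: I]) (sqmod (f i))%:E)) => s us.
  rewrite -lee_fin fineK ?ge0_fin_numE//.
  apply: esum_ge; exists [set` s].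
    by split => //; exact: finite_seq.
  by rewrite -fsbig_seq// sumEFin.
apply: (@le_lt_trans _ _ M%:E); last by rewrite ltry.
apply: ge_ereal_sup => _ [A [finA _] <-].
by rewrite fsbig_finite//= sumEFin lee_fin HM ?fset_uniq.
Qed.

Lemma l2_submod_closed : submod_closed l2_pred.
Proof.
split=> [|a f g /l2P[Mf Hf] /l2P[Mg Hg]]; apply/l2P.
  by exists 0 => s _; rewrite big1// => i _; rewrite /sqmod /= expr0n/= addr0.
exists (2 * (sqmod a * Mf) + 2 * Mg) => s us.
apply: (@le_trans _ _
    (\sum_(i <- s) (2 * (sqmod a * sqmod (f i)) + 2 * sqmod (g i)))).
  by apply: ler_sum => i _; rewrite -sqmodM; exact: sqmodD.
rewrite big_split/= -!mulr_sumr lerD// ler_pM2l//.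
  by rewrite ler_wpM2l ?sqmod_ge0 ?Hf.
exact: Hg.
Qed.

Lemma series_sum_term (F : I -> R) n :
  series (sum_term F) n = \sum_(i <- pmap pickle_inv (iota 0 n)) F i.
Proof.
rewrite /series /= /index_iota subn0.
elim: (iota 0 n) => [|k s IHs] /=; first by rewrite !big_nil.
by rewrite big_cons IHs /sum_term; case: pickle_inv => [i|] /=;
  rewrite ?big_cons// add0r.
Qed.

Lemma uniq_pickle n : uniq (pmap (@pickle_inv I) (iota 0 n)).
Proof. by apply: (pmap_uniq (@pickle_invK I)); exact: iota_uniq. Qed.

Lemma sumR_bounded (F : I -> R) (M : R) : (forall i, 0 <= F i) ->
  (forall s, uniq s -> \sum_(i <- s) F i <= M) ->
  cvgn (series (sum_term F)) /\ sumR F <= M.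
Proof.
move=> F0 FM; have ubM n : series (sum_term F) n <= M.
  by rewrite series_sum_term FM// uniq_pickle.
have cF : cvgn (series (sum_term F)).
  apply: nondecreasing_is_cvgn; last by exists M => _ [n _ <-].
  apply: nondecreasing_series => k _ _.
  by rewrite /sum_term; case: pickle_inv => /=.
by split => //; apply: limr_le => //; near=> n.
Unshelve. all: by end_near. Qed.

Lemma ler_sumR (F : I -> R) (s : seq I) : (forall i, 0 <= F i) ->
  cvgn (series (sum_term F)) -> uniq s -> \sum_(i <- s) F i <= sumR F.
Proof.
move=> F0 cF us; have [n sn] : exists n, forall i, i \in s -> (choice.pickle i < n)%N.
  exists (\max_(i <- s) choice.pickle i).+1 => i si.
  by rewrite ltnS leq_bigmax_seq.
apply: (@le_trans _ _ (series (sum_term F) n)); last first.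
  apply: nondecreasing_cvgn_le => //; apply: nondecreasing_series => k _ _.
  by rewrite /sum_term; case: pickle_inv => /=.
rewrite series_sum_term [leRHS](bigID (mem s))/=.
rewrite [X in _ <= X + _](_ : _ = \sum_(i <- s) F i).
  by rewrite lerDl sumr_ge0.
rewrite -big_filter; apply: perm_big; apply: uniq_perm => //; first by rewrite filter_uniq// uniq_pickle.
move=> i; rewrite mem_filter; apply: andb_idr => si.
rewrite mem_pmap; apply/mapP; exists (choice.pickle i); last by rewrite pickleK_inv.
by rewrite mem_iota add0n sn.
Qed.

Definition summableC (F : I -> R[i]) :=
  cvgn (series (sum_term (fun i => complex.Re (F i)))) /\
  cvgn (series (sum_term (fun i => complex.Im (F i)))).

Lemma eq_sumC (F G : I -> R[i]) : F =1 G -> sumC F = sumC G.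
Proof. by move=> /funext->. Qed.

Lemma eq_sumR (F G : I -> R) : F =1 G -> sumR F = sumR G.
Proof. by move=> /funext->. Qed.

Lemma sumR_comb (a b : R) (F G K : I -> R) :
  cvgn (series (sum_term F)) -> cvgn (series (sum_term G)) ->
  cvgn (series (sum_term K)) ->
  sumR (fun i => a * F i + b * G i + K i) = a * sumR F + b * sumR G + sumR K.
Proof.
move=> cF cG cK; rewrite /sumR.
have -> : sum_term (fun i => a * F i + b * G i + K i) =
    a *: sum_term F + b *: sum_term G + sum_term K.
  apply/funext => k; rewrite /sum_term !fctE /=.
  by case: pickle_inv => //=; rewrite !scaler0 !addr0.
have caF : cvgn (series (a *: sum_term F)) by exact: is_cvg_seriesZ.
have cbG : cvgn (series (b *: sum_term G)) by exact: is_cvg_seriesZ.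
rewrite lim_seriesD//; last exact: is_cvg_seriesD.
by rewrite lim_seriesD// !lim_seriesZ.
Qed.

Lemma sumC_linear (a : R[i]) (F G : I -> R[i]) : summableC F -> summableC G ->
  sumC (fun i => a * F i + G i) = a * sumC F + sumC G.
Proof.
case: a => a b [rF iF] [rG iG]; rewrite /sumC.
transitivity (sumR (fun i => a * complex.Re (F i) + (- b) * complex.Im (F i)
                            + complex.Re (G i)) +i*
              sumR (fun i => a * complex.Im (F i) + b * complex.Re (F i)
                            + complex.Im (G i))).
  by congr (_ +i* _); apply: eq_sumR => i;
    case: (F i) (G i) => ? ? [? ?] /=; ring.
by rewrite !sumR_comb//; apply/eqP; rewrite eq_complex /= mulNr !eqxx.
Qed.

Lemma l2_summable (f g : I -> R[i]) : f \in l2_pred -> g \in l2_pred ->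
  summableC (fun i => f i * (g i)^*%C).
Proof.
move=> /l2P[Mf Hf] /l2P[Mg Hg].
have [cfg _] : cvgn (series (sum_term (fun i => sqmod (f i) + sqmod (g i)))) /\
    sumR (fun i => sqmod (f i) + sqmod (g i)) <= Mf + Mg.
  apply: sumR_bounded => [i|s us]; first by rewrite addr_ge0// sqmod_ge0.
  by rewrite big_split/= lerD ?Hf ?Hg.
have dom (F : I -> R) : (forall i, `|F i| <= sqmod (f i) + sqmod (g i)) ->
    cvgn (series (sum_term F)).
  move=> HF; apply: normed_cvg; apply: series_le_cvg cfg => k //=.
    by rewrite /sum_term; case: pickle_inv => //= i; rewrite addr_ge0// sqmod_ge0.
  by rewrite /sum_term; case: pickle_inv => //=; rewrite normr0.
split; apply: dom => i; case: (f i) (g i) => a b [c d];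
  rewrite /sqmod /= ler_norml; apply/andP; split;
  have := sqr_ge0 (a - c); have := sqr_ge0 (b - d); have := sqr_ge0 (a + c);
  have := sqr_ge0 (b + d); have := sqr_ge0 (a - d); have := sqr_ge0 (b - c);
  have := sqr_ge0 (a + d); have := sqr_ge0 (b + c); nra.
Qed.

HB.instance Definition _ := [isSub for l2_val].
HB.instance Definition _ := [Choice of l2 by <:].
HB.instance Definition _ :=
  GRing.isSubmodClosed.Build R[i] (I -> R[i]) l2_pred l2_submod_closed.
HB.instance Definition _ := [SubChoice_isSubLmodule of l2 by <:].

Definition l2_inner (f g : l2) : R[i] := sumC (fun i => f i * (g i)^*%C).

Let l2_inner_linear g : scalar (l2_inner^~ g).
Proof.
move=> a f h; rewrite /l2_inner -(sumC_linear _ (l2_summable (valP f) (valP g))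
  (l2_summable (valP h) (valP g))).
by apply: eq_sumC => i /=; rewrite mulrDl mulrA.
Qed.

Let l2_inner_conj f g : l2_inner g f = (l2_inner f g)^*%C.
Proof.
have [rfg ifg] := l2_summable (valP f) (valP g).
rewrite /l2_inner /sumC /=; congr (_ +i* _).
  apply: eq_sumR => i; case: (f i) (g i) => a b [c d] /=; ring.
rewrite -[RHS]mulN1r /sumR -[RHS]lim_seriesZ//; congr (limn (series _)).
apply/funext => k; rewrite !fctE /sum_term; case: pickle_inv => [i|] /=.
  by case: (f i) (g i) => a b [c d] /=; rewrite /GRing.scale /=; ring.
by rewrite scaler0.
Qed.

Lemma l2_inner_sqmod f : l2_inner f f = (sumR (fun i => sqmod (f i)))%:C.
Proof.
rewrite /l2_inner /sumC; congr (_ +i* _).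
  by apply: eq_sumR => i; case: (f i) => a b; rewrite /sqmod /=; ring.
rewrite (@eq_sumR _ (fun=> 0)); last first.
  by move=> i; case: (f i) => a b /=; ring.
rewrite /sumR [X in series X](_ : _ = fun=> 0).
  by rewrite [series _](_ : _ = fun=> 0) ?lim_cst//; apply/funext => n;
    rewrite /series/= big1.
by apply/funext => k; rewrite /sum_term; case: pickle_inv.
Qed.

Lemma l2_cvg (f : l2) : cvgn (series (sum_term (fun i => sqmod (f i)))).
Proof.
have /l2P[M HM] := valP f.
by have [] := sumR_bounded (fun i => sqmod_ge0 (f i)) HM.
Qed.

Lemma sum_sqmod_le (f : l2) s : uniq s ->
  \sum_(i <- s) sqmod (f i) <= sumR (fun i => sqmod (f i)).
Proof.
move=> us; apply: (@ler_sumR (fun i => sqmod (f i)) s) => //.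
  by move=> i; exact: sqmod_ge0.
exact: l2_cvg.
Qed.

Let l2_inner_ge0 f : 0 <= l2_inner f f.
Proof.
by rewrite l2_inner_sqmod ler0c; have := sum_sqmod_le f (isT : uniq [::]); rewrite big_nil.
Qed.

Let l2_inner_eq0 f : l2_inner f f = 0 -> f = 0.
Proof.
rewrite l2_inner_sqmod => -[f0]; apply: val_inj; apply/funext => i /=.
have := sum_sqmod_le f (isT : uniq [:: i]); rewrite big_seq1 f0 => fi0.
have : sqmod (f i) == 0 by rewrite eq_le fi0 sqmod_ge0.
case: (f i) => a b; rewrite /sqmod /= paddr_eq0 ?sqr_ge0// !sqrf_eq0.
by case/andP=> /eqP-> /eqP->.
Qed.

Let l2_complete (u : nat -> l2) :
  (forall e : R, 0 < e -> exists N, forall m n, (N <= m)%N -> (N <= n)%N ->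
     l2_inner (u m - u n) (u m - u n) <= (e ^+ 2)%:C) ->
  exists l, forall e : R, 0 < e -> exists N, forall n, (N <= n)%N ->
     l2_inner (u n - l) (u n - l) <= (e ^+ 2)%:C.
Proof.
move=> uC.
have uC1 (e : R) : 0 < e -> exists N, forall m n s, (N <= m)%N -> (N <= n)%N ->
    uniq s -> \sum_(i <- s) sqmod (u m i - u n i) <= e ^+ 2.
  move=> /uC[N HN]; exists N => m n s Nm Nn us.
  have := HN m n Nm Nn; rewrite l2_inner_sqmod lecR; apply: le_trans.
  exact: (sum_sqmod_le (u m - u n)).
have cv (p : R[i] -> R) : {morph p : x y / x - y} ->
    (forall z, p z ^+ 2 <= sqmod z) -> forall i, cvgn (fun n => p (u n i)).
  move=> pB psq i; apply/cauchy_cvgP/cauchyP => e e0.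
  have e2 : 0 < e / 2 by rewrite divr_gt0.
  have [N HN] := uC1 _ e2; exists (p (u N i)).
  change (\forall n \near \oo, ball (p (u N i)) e (p (u n i))); near=> n.
  rewrite -ball_normE /= -pB; apply: (@le_lt_trans _ _ (e / 2)).
    rewrite -(ler_pXn2r (ltn0Sn 1)) ?nnegrE ?(ltW e2)// real_normK ?num_real//.
    apply: le_trans (psq _) _.
    have := HN N n [:: i] (leqnn N); rewrite big_seq1; apply => //.
    by near: n; exact: nbhs_infty_ge.
  by rewrite ltr_pdivrMr// ltr_pMr// ltr1n.
have cRe i : cvgn (fun n => complex.Re (u n i)).
  apply: (cv (@complex.Re R)); first by move=> [? ?] [? ?].
  by move=> z; rewrite lerDl sqr_ge0.
have cIm i : cvgn (fun n => complex.Im (u n i)).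
  apply: (cv (@complex.Im R)); first by move=> [? ?] [? ?].
  by move=> z; rewrite lerDr sqr_ge0.
pose l i := limn (fun n => complex.Re (u n i)) +i* limn (fun n => complex.Im (u n i)).
have lE (e : R) : 0 < e -> exists N, forall n s, (N <= n)%N ->
    uniq s -> \sum_(i <- s) sqmod (u n i - l i) <= e ^+ 2.
  move=> /uC1[N HN]; exists N => n s Nn us.
  have cvs : (fun m => \sum_(i <- s) sqmod (u n i - u m i)) @ \oo -->
      \sum_(i <- s) sqmod (u n i - l i).
    apply: cvg_big => [|i _]; first exact: add_continuous.
    rewrite /sqmod.
    under eq_fun do rewrite !raddfB /=.
    rewrite !raddfB /=.
    by apply: cvgD; rewrite expr2; under eq_fun do rewrite expr2;
      apply: cvgM; apply: cvgB => //; exact: cvg_cst.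
  rewrite -(cvg_lim _ cvs)//; apply: limr_le; first exact: cvgP cvs.
  by near=> m; apply: HN => //; near: m; exact: nbhs_infty_ge.
have l_l2 : l \in l2_pred.
  have [N HN] := lE 1 ltr01.
  have ul2 : (fun i => u N i - l i) \in l2_pred.
    by apply/l2P; exists (1 ^+ 2) => s; exact: HN.
  have -> : l = (l2_val (u N) : I -> R[i]) - (fun i => u N i - l i).
    by apply/funext => i; rewrite !fctE opprB addrCA subrr addr0.
  by rewrite rpredB// (valP (u N)).
exists (L2 l_l2) => e /lE[N HN]; exists N => n Nn.
rewrite l2_inner_sqmod lecR.
by have [] := @sumR_bounded (fun i => sqmod (u n i - l i)) (e ^+ 2)
  (fun i => sqmod_ge0 _) (fun s => HN n s Nn).
Unshelve. all: by end_near. Qed.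

HB.instance Definition _ := Lmodule_isHilbert.Build R l2
  l2_inner_linear l2_inner_conj l2_inner_ge0 l2_inner_eq0 l2_complete.

End SquareSummable.

Lemma inner_l2E (R : realType) (I : countType) (f g : l2 R I) :
  inner f g = sumC (fun i => l2_val f i * (l2_val g i)^*%C).
Proof. by []. Qed.

(* Operators on [H] are functions [H -> H] lying in [bounded_ops]; addition and
   scaling are the pointwise ones of the library, multiplication is [\o]. *)
Section Operators.
Context (R : realType) (H : hilbertType R).
Implicit Types (X Y : H -> H) (A F G : set (H -> H)).

Definition bounded_ops : set (H -> H) := [set X | linear X /\ continuous X].

(* [get] picks the adjoint, which exists and is unique for bounded [X]. *)
Definition adj X : H -> H :=
  get [set Y | forall x y, inner (X x) y = inner x (Y y)].

Definition norm_closed A := forall X, bounded_ops X ->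
  (forall e : R, 0 < e ->
     exists2 Y, A Y & forall x, `|X x - Y x| <= e%:C * `|x|) -> A X.

Definition wot_closed A := forall X, bounded_ops X ->
  (forall (e : R) (s : seq (H * H)), 0 < e ->
     exists2 Y, A Y &
       forall p, p \in s -> `|inner (X p.1 - Y p.1) p.2| < e%:C) -> A X.

Definition op_subspace A :=
  [/\ A `<=` bounded_ops, A 0
    & forall (a : R[i]) X Y, A X -> A Y -> A (a *: X + Y)].

Definition unital_subalgebra A :=
  [/\ op_subspace A, A idfun & forall X Y, A X -> A Y -> A (X \o Y)].

Definition norm_closed_algebra G : set (H -> H) :=
  smallest [set A | unital_subalgebra A /\ norm_closed A] G.

Definition wot_closed_algebra G : set (H -> H) :=
  smallest [set A | unital_subalgebra A /\ wot_closed A] G.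

Definition Cstar_algebra G : set (H -> H) :=
  smallest [set A | [/\ unital_subalgebra A, norm_closed A
                      & forall X, A X -> A (adj X)]] G.

Definition two_sided_ideal F A :=
  [/\ A `<=` F, op_subspace A
    & forall X Y, F X -> A Y -> A (X \o Y) /\ A (Y \o X)].

Definition wot_closed_ideal F G : set (H -> H) :=
  smallest [set A | two_sided_ideal F A /\ wot_closed A] G.

(* Positivity of the operator matrix [X] on the direct sum of [m] copies
   of [H]. *)
Definition positive_opmx m (X : 'I_m -> 'I_m -> H -> H) :=
  forall x : 'I_m -> H, 0 <= \sum_i \sum_j inner (X i j (x j)) (x i).

(* Orthogonal projection onto [perp M], as a map into that subspace. *)
Definition proj (M : set H) (x : H) : perp M :=
  get [set z : perp M | forall y : perp M, inner (x - val z) (val y) = 0].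

End Operators.

Arguments bounded_ops {R} H.
Arguments proj {R H} M.

Section CompletelyPositive.
Context (R : realType) (K H : hilbertType R).

(* The domain of [mu] is the set [A] of operators on [K]; the values of [mu]
   outside [A] are irrelevant. *)
Definition unital_cp_map (A : set (K -> K)) (mu : (K -> K) -> (H -> H)) :=
  [/\ forall X, A X -> bounded_ops H (mu X),
      forall (a : R[i]) X Y, A X -> A Y -> mu (a *: X + Y) = a *: mu X + mu Y,
      mu idfun = idfun
    & forall m (X : 'I_m -> 'I_m -> K -> K), (forall i j, A (X i j)) ->
        positive_opmx X -> positive_opmx (fun i j => mu (X i j))].

(* By linearity, quantifying over the products [B \o adj C] amounts to
   quantifying over their linear span. *)
Definition poisson_transform (G : set (K -> K)) (mu : (K -> K) -> (H -> H)) :=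
  unital_cp_map (Cstar_algebra G) mu /\
  forall A B C, norm_closed_algebra G A -> norm_closed_algebra G B ->
    norm_closed_algebra G C ->
    mu (A \o (B \o adj C)) = mu A \o mu (B \o adj C).

End CompletelyPositive.

(* The index set of the generators: [None] stands for [n = oo]. *)
Definition gen (n : option nat) : countType :=
  if n is Some m then 'I_m : countType else nat.

(* The free semigroup on [gen n], with neutral element [[::]], and the
   free semigroup algebra as finitely supported functions. *)
Notation word n := (seq (gen n)).
Notation free_algebra R n := {fsfun word n -> R[i] with 0}.

Section Words.
Context (R : realType) (n : option nat) (H : hilbertType R).
Implicit Types (T : gen n -> H -> H) (p : free_algebra R n).

Definition word_op T (a : word n) : H -> H :=
  foldr (fun i X => T i \o X) idfun a.

Definition eval_op T p : H -> H := \sum_(a <- finsupp p) p a *: word_op T a.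

Definition homogeneous p :=
  exists k, forall a, a \in finsupp p -> size a = k.

(* [\sum_i T_i T_i^* <= I], the sum being in the weak operator sense when
   [n = oo]. *)
Definition row_contraction T :=
  (forall i, bounded_ops H (T i)) /\
  forall x, (\esum_(i in [set: gen n]) (complex.Re (inner (T i (adj (T i) x)) x))%:E
             <= (complex.Re (inner x x))%:E)%E.

End Words.

Section Fock.
Context (R : realType) (n : option nat).

(* The full Fock space in the coordinates of its orthonormal basis
   [e_a = e_i1 (x) .. (x) e_ik], [a = [:: i1; ..; ik]]. *)
Definition fock : hilbertType R := l2 R (word n).

(* The coordinates of [e_i (x) f]. *)
Definition creation_fun (i : gen n) (f : word n -> R[i]) (w : word n) : R[i] :=
  if w is j :: v then (if j == i then f v else 0) else 0.

Lemma creation_l2 i (f : fock) : creation_fun i (l2_val f) \in @l2_pred R (word n).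
Proof.
have /l2P[M HM] := valP f.
pose g (w : word n) := if w is j :: v then (if j == i then Some v else None) else None.
apply/l2P; exists M => s us.
have us' : uniq (pmap g s).
  apply: (@pmap_uniq _ _ g (cons i)) us => -[|j v] //=.
  by case: eqP => //= ->.
apply: le_trans (HM _ us'); elim: s {us us'} => [|w s IHs] /=.
  by rewrite !big_nil.
have sq0 : sqmod (0 : R[i]) = 0 by rewrite /sqmod /= expr0n/= addr0.
rewrite big_cons; case: w => [|j v] /=; first by rewrite sq0 add0r.
by case: eqP => _ /=; rewrite ?big_cons ?lerD2l// sq0 add0r.
Qed.

Definition creation (i : gen n) (f : fock) : fock := L2 (creation_l2 i f).

(* The noncommutative analytic Toeplitz algebra. *)
Definition Finfty : set (fock -> fock) :=
  wot_closed_algebra (range creation).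

Definition ideal_of (P : set (free_algebra R n)) : set (fock -> fock) :=
  wot_closed_ideal Finfty [set eval_op creation p | p in P].

(* The set [J F^2(H_n)]; [NJ P] is its orthogonal complement. *)
Definition ideal_range (P : set (free_algebra R n)) : set fock :=
  [set x | exists X f, ideal_of P X /\ x = X f].

Definition NJ P : hilbertType R := perp (ideal_range P).

(* [B_i = P_(N_J) S_i |_(N_J)]. *)
Definition compressed_creation P (i : gen n) : NJ P -> NJ P :=
  fun x => proj (ideal_range P) (creation i (val x)).

End Fock.

(* Main.v *)
Require Import Defs.
From HB Require Import structures.
From mathcomp Require Import all_boot all_order all_algebra finmap.
From mathcomp Require Import all_classical all_reals all_analysis.
From mathcomp Require Import complex.
From mathcomp Require Import ring lra.

Set Implicit Arguments.
Unset Strict Implicit.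
Unset Printing Implicit Defensive.
Import Order.TTheory GRing.Theory Num.Theory numFieldNormedType.Exports.
Local Open Scope classical_set_scope.
Local Open Scope ring_scope.
Local Open Scope complex_scope.

(** A Poisson transform on C*(B) is a unital completely positive map [mu] with
    [mu (B_i B_i^* )] = [mu B_i] [mu B_i]^*: by Choi's multiplicative domain
    argument this identity on the generators already gives
    [mu (A X)] = [mu A] [mu X] for every [A] in the norm closed algebra and
    every [X] in C*(B).  Positivity of [mu] on I - sum B_i B_i^* turns
    [mu B_i] into a row contraction, and p(B) = 0 is transported by [mu].

    Conversely, let [T] be a row contraction annihilated by [Ph] and let
    C_i = r T_i^* with r < 1.  For a linear functional [lam] dominated by the
    defect form D(u,v) = <u,v> - sum_i <C_i u, C_i v>, the Poisson kernel
    L x = (w |-> lam (C_w x)) takes its values in N_J, by homogeneity of [Ph],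
    and satisfies B_i^* L = L C_i.  Approximating D on finite sets from below
    by finite sums of |lam|^2, the completely positive forms
    (x,y) |-> sum_k <X L_k x, L_k y> are almost unital and almost map
    B_a B_b^* to T_a T_b^*.  An ultralimit over all finite sets of vectors, with
    r -> 1, is the required map. *)

(** * Hilbert spaces and bounded operators *)

(** The classical Poisson kernel takes values in the tensor product of N_J with a defect space and
    involves the square root of the defect operator. Neither is built here: a functional [lam] plays
    the role of one scalar coordinate of that square root, and finitely many of them suffice for
    finitely many vectors. The factor r makes the row pure: iterating |u|^2 = D(u,u) + sum_i |C_i
    u|^2 leaves a geometrically small remainder, so no norm is lost and the limit is unital.
    Homogeneity makes p(rT) a scalar multiple of p(T), so the scaling keeps the constraints. The
    limit is taken on forms, for all bounded operators on N_J at once, and Riesz turns each limit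
    form into an operator; nothing has to be extended by continuity from the span of the B_a B_b^* .
    Weak limits do not respect products, so multiplicativity is recovered afterwards from the values
    at B_i and B_i B_i^* . *)

Section RealPart.
Context (R : realType) (H : hilbertType R).
Implicit Types (x y z u v : H) (a : R[i]).

Lemma innerDl x y z : inner (x + y) z = inner x z + inner y z.
Proof. exact: (@form_Dl R H inner inner_linear). Qed.

Lemma inner0l z : inner 0 z = 0 :> R[i].
Proof. exact: (@form_0l R H inner inner_linear). Qed.

Lemma innerZl a x z : inner (a *: x) z = a * inner x z.
Proof. exact: (@form_Zl R H inner inner_linear). Qed.

Lemma innerDr x y z : inner z (x + y) = inner z x + inner z y.
Proof. exact: (@form_Dr R H inner inner_linear inner_conj). Qed.

Lemma innerZr a x z : inner z (a *: x) = a^*%C * inner z x.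
Proof. exact: (@form_Zr R H inner inner_linear inner_conj). Qed.

Lemma inner0r z : inner z 0 = 0 :> R[i].
Proof. by rewrite inner_conj inner0l rmorph0. Qed.

Lemma innerNl x z : inner (- x) z = - inner x z.
Proof. by rewrite -scaleN1r innerZl mulN1r. Qed.

Lemma innerNr x z : inner z (- x) = - inner z x.
Proof. by rewrite inner_conj innerNl rmorphN /= -inner_conj. Qed.

Lemma innerBl x y z : inner (x - y) z = inner x z - inner y z.
Proof. by rewrite innerDl innerNl. Qed.

Lemma inner_suml (I : Type) (s : seq I) (P : pred I) (F : I -> H) z :
  inner (\sum_(i <- s | P i) F i) z = \sum_(i <- s | P i) inner (F i) z.
Proof.
apply: (big_morph (fun x => inner x z)); last exact: inner0l.
by move=> x y; exact: innerDl.
Qed.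

Lemma inner_sumr (I : Type) (s : seq I) (P : pred I) (F : I -> H) z :
  inner z (\sum_(i <- s | P i) F i) = \sum_(i <- s | P i) inner z (F i).
Proof.
apply: (big_morph (inner z)); last exact: inner0r.
by move=> x y; exact: innerDr.
Qed.

Lemma inner_extl x y : (forall z, inner x z = inner y z) -> x = y.
Proof.
move=> xy; apply/eqP; rewrite -subr_eq0; apply/eqP.
by apply: inner_eq0; rewrite innerBl xy subrr.
Qed.

Lemma inner_extr x y : (forall z, inner z x = inner z y) -> x = y.
Proof.
by move=> xy; apply: inner_extl => z; rewrite inner_conj xy -inner_conj.
Qed.

(** Estimates are made in [R] with squared norms: the order is total there, real arithmetic applies,
    and no square roots appear. *)
Definition rinner x y : R := complex.Re (inner x y).
Definition nsq x : R := rinner x x.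

(** Since <x, i y> = - i <x, y>, the imaginary part is itself a real part, so complex identities
    reduce to real ones. *)
Lemma innerE x y : inner x y = rinner x y +i* rinner x ('i *: y).
Proof.
rewrite /rinner innerZr; case: (inner x y) => a b.
by apply/eqP; rewrite eq_complex /= mul0r mulN1r opprK add0r !eqxx.
Qed.

Lemma rinnerC x y : rinner x y = rinner y x.
Proof. by rewrite /rinner inner_conj; case: (inner y x). Qed.

Lemma rinnerDl x y z : rinner (x + y) z = rinner x z + rinner y z.
Proof. by rewrite /rinner innerDl raddfD. Qed.

Lemma rinnerDr x y z : rinner z (x + y) = rinner z x + rinner z y.
Proof. by rewrite /rinner innerDr raddfD. Qed.

Lemma rinnerNl x z : rinner (- x) z = - rinner x z.
Proof. by rewrite /rinner innerNl raddfN. Qed.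

Lemma rinnerNr x z : rinner z (- x) = - rinner z x.
Proof. by rewrite /rinner innerNr raddfN. Qed.

Lemma ReZ (t : R) (z : R[i]) : complex.Re (t%:C * z) = t * complex.Re z.
Proof. by case: z => a b /=; rewrite mul0r subr0. Qed.

Lemma conjcR (t : R) : (t%:C)^*%C = t%:C.
Proof. by rewrite /= oppr0. Qed.

Lemma rinnerZl (t : R) x z : rinner (t%:C *: x) z = t * rinner x z.
Proof. by rewrite /rinner innerZl ReZ. Qed.

Lemma rinnerZr (t : R) x z : rinner z (t%:C *: x) = t * rinner z x.
Proof. by rewrite rinnerC rinnerZl rinnerC. Qed.

Lemma nsqE x : inner x x = (nsq x)%:C.
Proof.
have := inner_ge0 x; rewrite /nsq /rinner; case: (inner x x) => a b.
by rewrite lecE /= => /andP[/eqP-> _].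
Qed.

Lemma nsq_ge0 x : 0 <= nsq x.
Proof. by have := inner_ge0 x; rewrite nsqE ler0c. Qed.

Lemma nsq0 : nsq 0 = 0.
Proof. by rewrite /nsq /rinner inner0l. Qed.

Lemma nsq_eq0 x : nsq x = 0 -> x = 0.
Proof. by move=> x0; apply: inner_eq0; rewrite nsqE x0. Qed.

Lemma nsqZ a x : nsq (a *: x) = sqmod a * nsq x.
Proof.
rewrite {1}/nsq /rinner innerZl innerZr nsqE mulrA.
case: a => a b; rewrite /sqmod /=; ring.
Qed.

Lemma nsqN x : nsq (- x) = nsq x.
Proof. by rewrite /nsq rinnerNl rinnerNr opprK. Qed.

Lemma nsqD x y : nsq (x + y) = nsq x + 2 * rinner x y + nsq y.
Proof. rewrite /nsq !(rinnerDl, rinnerDr) (rinnerC y x); ring. Qed.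

Lemma nsqB x y : nsq (x - y) = nsq x - 2 * rinner x y + nsq y.
Proof. rewrite nsqD nsqN rinnerNr; ring. Qed.

Lemma nsqBC x y : nsq (x - y) = nsq (y - x).
Proof. by rewrite -nsqN opprB. Qed.

Lemma nsqD_le x y : nsq (x + y) <= 2 * nsq x + 2 * nsq y.
Proof. have := nsq_ge0 (x - y); rewrite nsqB nsqD; lra. Qed.

Lemma rinner_CS x y : rinner x y ^+ 2 <= nsq x * nsq y.
Proof.
have [y0|yN0] := eqVneq (nsq y) 0.
  by rewrite y0 (nsq_eq0 y0) /rinner inner0r expr0n mulr0.
have y0 : 0 < nsq y by rewrite lt_def yN0 nsq_ge0.
have := nsq_ge0 ((nsq y)%:C *: x - (rinner x y)%:C *: y).
rewrite nsqB !nsqZ rinnerZl rinnerZr /sqmod /= !expr0n /= !addr0.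
rewrite (_ : _ - _ + _ = nsq y * (nsq x * nsq y - rinner x y ^+ 2)); last by ring.
by rewrite pmulr_rge0// subr_ge0.
Qed.

Lemma norm_nsq x (e : R) : 0 <= e -> (`|x| <= e%:C) = (nsq x <= e ^+ 2).
Proof.
move=> e0; rewrite -lecR -nsqE inner_norm rmorphXn /=.
by rewrite ler_pXn2r ?nnegrE ?ler0c.
Qed.

Lemma norm_nsq_eq x : `|x| = (Num.sqrt (nsq x))%:C.
Proof.
apply/eqP; rewrite -(@eqrXn2 _ 2)// ?ler0c ?sqrtr_ge0// -inner_norm nsqE.
by rewrite -rmorphXn /= sqr_sqrtr ?nsq_ge0.
Qed.

Lemma nsq_complete (u : nat -> H) :
  (forall e : R, 0 < e -> exists N, forall m n, (N <= m)%N -> (N <= n)%N ->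
     nsq (u m - u n) <= e) ->
  exists l, forall e : R, 0 < e -> exists N, forall n, (N <= n)%N ->
     nsq (u n - l) <= e.
Proof.
have toR (e : R[i]) : 0 < e -> exists2 r : R, 0 < r & e = r%:C.
  move=> e0; have /complex_realP[r er] : e \is Num.real by rewrite gtr0_real.
  by exists r => //; move: e0; rewrite er ltcR.
move=> uC.
have /cauchy_cvgP/cvg_ex[/= l ul] : cauchy (u @ \oo).
  apply/cauchyP => e /toR[r r0 ->].
  have r2 : 0 < r / 2 by rewrite divr_gt0.
  have [N HN] := uC _ (exprn_gt0 2 r2); exists (u N).
  change (\forall n \near \oo, ball (u N) r%:C (u n)); near=> n.
  rewrite -ball_normE /=; apply: (@le_lt_trans _ _ (r / 2)%:C).
    rewrite norm_nsq ?(ltW r2)//; apply: HN => //; near: n; exact: nbhs_infty_ge.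
  by rewrite ltcR ltr_pdivrMr// ltr_pMr// ltr1n.
exists l => e e0; have s0 : 0 < Num.sqrt e by rewrite sqrtr_gt0.
have s0' : 0 < (Num.sqrt e)%:C :> R[i] by rewrite ltcR.
have /cvgrPdist_lt/(_ _ s0') [N _ HN] := ul.
exists N => n /HN /= /ltW; rewrite norm_nsq ?(ltW s0)// sqr_sqrtr ?(ltW e0)//.
by rewrite nsqBC.
Unshelve. all: by end_near. Qed.

End RealPart.

Lemma norm_le_nsq (R : realType) (H K : hilbertType R) (x : H) (y : K) (e : R) : 0 <= e ->
  (`|x| <= e%:C * `|y|) = (nsq x <= e ^+ 2 * nsq y).
Proof.
move=> e0; rewrite !norm_nsq_eq -rmorphM /= lecR.
rewrite -[in RHS](sqr_sqrtr (nsq_ge0 x)) -[in RHS](sqr_sqrtr (nsq_ge0 y)).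
by rewrite -exprMn ler_pXn2r ?nnegrE ?mulr_ge0 ?sqrtr_ge0.
Qed.

(** * The Riesz representation theorem *)

Section Riesz.
Context (R : realType) (H : hilbertType R).

(** The representing vector is obtained as the minimizer of [q]: if z represents [phi], then q x =
    |x - z|^2 - |z|^2. *)
Lemma riesz (phi : H -> R[i]) (M : R) : scalar phi ->
  (forall x, sqmod (phi x) <= M * nsq x) ->
  exists z, forall x, phi x = inner x z.
Proof.
move=> lin bnd.
have phiD x y : phi (x + y) = phi x + phi y.
  by have := lin 1 x y; rewrite scale1r mul1r.
have phi0 : phi 0 = 0.
  by have := phiD 0 0; rewrite addr0 -{1}[phi 0]addr0 => /addrI.
have phiZ a x : phi (a *: x) = a * phi x.
  by have := lin a x 0; rewrite !addr0 phi0 addr0.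
pose p x := complex.Re (phi x).
have pD x y : p (x + y) = p x + p y by rewrite /p phiD raddfD.
have pZ (t : R) x : p (t%:C *: x) = t * p x by rewrite /p phiZ ReZ.
have pbnd x : p x ^+ 2 <= M * nsq x.
  by apply: le_trans (bnd x); rewrite lerDl sqr_ge0.
pose q x := nsq x - 2 * p x.
(* With s = p x and N = nsq x, a value q x < -|M| would give (N + |M|)^2 < 4 s^2 <= 4 |M| N, against
   (N - |M|)^2 >= 0. *)
have qM x : - `|M| <= q x.
  have := pbnd x; have := ler_norm M; have := nsq_ge0 x; rewrite /q.
  move: (p x) (nsq x) (normr_ge0 M) => s N M0 N0 MM sN.
  have {}sN : s ^+ 2 <= `|M| * N.
    by apply: le_trans sN _; rewrite ler_wpM2r.
  rewrite leNgt; apply/negP => lt.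
  have h1 : (N + `|M|) ^+ 2 < (2 * s) ^+ 2.
    by rewrite ltr_pXn2r ?nnegrE//; lra.
  have := sqr_ge0 (N - `|M|); rewrite leNgt => /negP; apply.
  by move: h1 sN; rewrite !expr2; lra.
have hq : has_inf (range q).
  split; first by exists (q 0); exists 0.
  by exists (- `|M|) => _ [x _ <-].
set m := inf (range q).
have mq x : m <= q x by apply: ge_inf; [case: hq|exists x].
have uE k : exists x, q x < m + k.+1%:R^-1.
  have [|_ [x _ <-]] := @inf_adherent _ (range q) k.+1%:R^-1 _ hq.
    by rewrite invr_gt0.
  by exists x.
have [u uP] := choice uE.
have small (e : R) : 0 < e -> exists N, forall n, (N <= n)%N -> (n.+1%:R^-1 : R) <= e.
  move=> e0; exists (Num.truncn e^-1) => n Nn.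
  rewrite -[leRHS]invrK lef_pV2 ?posrE ?invr_gt0//.
  apply: ltW; apply: lt_le_trans (truncnS_gt _) _.
  by rewrite ler_nat.
(* Parallelogram law; the linear terms cancel, so two near-minimizers of [q] are close to each
   other. *)
have para x y : nsq (x - y) = 2 * q x + 2 * q y - 4 * q ((2^-1)%:C *: (x + y)).
  rewrite /q pZ nsqZ /sqmod /= expr0n/= addr0 nsqB nsqD pD; field => //.
have [|l lP] := @nsq_complete _ _ u.
  move=> e e0.
  have [N HN] := small (e / 4) (divr_gt0 e0 (ltr0Sn _ 3)).
  exists N => i k /HN Hi /HN Hk; rewrite para.
  have := uP i; have := uP k; have := mq ((2^-1)%:C *: (u i + u k)).
  move: (i.+1%:R^-1) (k.+1%:R^-1) Hi Hk (q _) (q _) (q _) => *; lra.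
have main y : p y = rinner y l.
  set N := nsq y; have N0 : 0 <= N := nsq_ge0 y.
  (* The two summands come from the squares of <y, u k> - p y and <y, u k - l>, each doubled by (a +
     b)^2 <= 2 a^2 + 2 b^2. *)
  suff H0 : forall e : R, 0 < e -> (p y - rinner y l) ^+ 2 <= e * (2 * (1 + N) + 2 * N).
    apply/eqP; rewrite -subr_eq0 -sqrf_eq0; apply/eqP/le_anti.
    rewrite sqr_ge0 andbT; apply/ler_addgt0Pl => e e0; rewrite addr0.
    have K0 : 0 < 2 * (1 + N) + 2 * N by lra.
    by have := H0 _ (divr_gt0 e0 K0); rewrite divfK// gt_eqF.
  move=> e e0; have [N1 HN1] := small e e0; have [N2 HN2] := lP e e0.
  set k := maxn N1 N2.
  have ek := HN1 k (leq_maxl _ _); have lk := HN2 k (leq_maxr _ _).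
  pose d := rinner y (u k) - p y.
  have dP : d ^+ 2 <= e * (1 + N).
    (* Near-minimality is tested along y. The best step would be -d/N; the denominator 1 + N keeps
       it meaningful when y = 0. *)
    pose t := - (d / (1 + N)).
    have := mq (u k + t%:C *: y); rewrite /q nsqD pD pZ rinnerZr nsqZ.
    rewrite /sqmod /= expr0n/= addr0 -/N (rinnerC (u k)).
    have := uP k; rewrite /q; move: (k.+1%:R^-1) ek => ek' ek u1 u2.
    have {u1 u2} : 0 <= e + 2 * t * d + t ^+ 2 * N by rewrite /d; lra.
    have N1' : 1 + N != 0 by rewrite gt_eqF//; lra.
    have Np : 0 < 1 + N by lra.
    rewrite (_ : e + _ + _ = (e * (1 + N) ^+ 2 - d ^+ 2 * (2 + N)) / (1 + N) ^+ 2).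
      rewrite pmulr_lge0 ?invr_gt0 ?exprn_gt0// subr_ge0 => h.
      have d0 := sqr_ge0 d.
      have : d ^+ 2 * (1 + N) <= e * (1 + N) * (1 + N).
        apply: le_trans (_ : d ^+ 2 * (2 + N) <= _); last by rewrite -mulrA.
        by rewrite ler_wpM2l//; lra.
      by rewrite ler_pM2r.
    by rewrite /t; field.
  have d2 : rinner y (u k - l) ^+ 2 <= N * e.
    by apply: le_trans (rinner_CS _ _) _; rewrite ler_wpM2l.
  move: dP d2; rewrite /d rinnerDr rinnerNr.
  move: (rinner y (u k)) (rinner y l) (p y) => a b c.
  have := sqr_ge0 ((a - c) + (a - b)); nra.
exists l => x; rewrite innerE.
have -> : rinner x ('i *: l) = - rinner ('i *: x) l.
  rewrite /rinner innerZl innerZr; case: (inner x l) => a b /=; ring.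
rewrite -!main /p phiZ; case: (phi x) => a b.
by apply/eqP; rewrite eq_complex /= mul0r mul1r sub0r opprK !eqxx.
Qed.

End Riesz.

Section LinearMaps.
Context (R : realType) (V W : lmodType R[i]).
Implicit Types (X : V -> W) (x y : V) (a : R[i]).

Lemma op_linearD X x y : linear X -> X (x + y) = X x + X y.
Proof. by move=> lX; have := lX 1 x y; rewrite !scale1r. Qed.

Lemma op_linear0 X : linear X -> X 0 = 0.
Proof.
by move=> /(op_linearD 0 0); rewrite addr0 -{1}[X 0]addr0 => /addrI.
Qed.

Lemma op_linearZ X a x : linear X -> X (a *: x) = a *: X x.
Proof.
by move=> lX; have := lX a x 0; rewrite !addr0 (op_linear0 lX) addr0.
Qed.

Lemma op_linear_sum X (I : Type) (s : seq I) (c : I -> R[i]) (f : I -> V) :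
  linear X -> X (\sum_(i <- s) c i *: f i) = \sum_(i <- s) c i *: X (f i).
Proof.
move=> lX; elim: s => [|i s IHs]; first by rewrite !big_nil (op_linear0 lX).
by rewrite !big_cons lX IHs.
Qed.

End LinearMaps.

(** * Bounded operators and their adjoints *)

Section BoundedOperators.
Context (R : realType) (H : hilbertType R).
Implicit Types (X Y Z : H -> H) (x y z : H) (a : R[i]).

Lemma bounded_opsP X : bounded_ops H X <->
  linear X /\ exists2 M : R, 0 <= M & forall x, nsq (X x) <= M * nsq x.
Proof.
split=> -[lX].
  pose XL := GRing.isLinear.Build R[i] H H *:%R X lX.
  pose f : {linear H -> H} := HB.pack X XL.
  move=> cX; split=> //.
  have /linear_boundedP[m [mreal mP]] : bounded_near f (nbhs 0).
    exact/linear_bounded_continuous.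
  have /complex_realP[m' em] := mreal.
  exists ((`|m'| + 1) ^+ 2); first exact: sqr_ge0.
  move=> x; rewrite -norm_le_nsq ?addr_ge0//; apply: mP.
  by rewrite em ltcR (le_lt_trans (ler_norm _))// ltrDl.
move=> [M M0 HM]; split=> //.
pose XL := GRing.isLinear.Build R[i] H H *:%R X lX.
pose f : {linear H -> H} := HB.pack X XL.
suff : continuous f by [].
apply/linear_bounded_continuous/linear_boundedP.
exists (Num.sqrt M)%:C; split; first by apply/complex_realP; exists (Num.sqrt M).
move=> r /ltW Mr x; apply: (@le_trans _ _ ((Num.sqrt M)%:C * `|x|)).
  by rewrite norm_le_nsq ?sqrtr_ge0// sqr_sqrtr.
by rewrite ler_wpM2r.
Qed.

Lemma bounded_id : bounded_ops H idfun.
Proof.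
by apply/bounded_opsP; split=> //; exists 1 => // x; rewrite mul1r.
Qed.

Lemma bounded_comp X Y :
  bounded_ops H X -> bounded_ops H Y -> bounded_ops H (X \o Y).
Proof.
move=> /bounded_opsP[lX [M M0 HM]] /bounded_opsP[lY [N N0 HN]].
apply/bounded_opsP; split=> [b x y|] /=; first by rewrite lY lX.
exists (M * N); first exact: mulr_ge0.
by move=> x; apply: le_trans (HM _) _; rewrite -mulrA ler_wpM2l.
Qed.

Lemma bounded_0 : bounded_ops H 0.
Proof.
have E x : (0 : H -> H) x = 0 by [].
apply/bounded_opsP; split=> [b x y|]; first by rewrite !E scaler0 addr0.
by exists 0 => // x; rewrite E nsq0 mul0r.
Qed.

Lemma bounded_comb a X Y :
  bounded_ops H X -> bounded_ops H Y -> bounded_ops H (a *: X + Y).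
Proof.
move=> /bounded_opsP[lX [M M0 HM]] /bounded_opsP[lY [N N0 HN]].
have E x : (a *: X + Y) x = a *: X x + Y x by [].
apply/bounded_opsP; split=> [b x y|].
  by rewrite !E lX lY !scalerDr !scalerA (mulrC a) addrACA.
exists (2 * (sqmod a * M) + 2 * N).
  by rewrite addr_ge0 ?mulr_ge0// sqmod_ge0.
move=> x; rewrite E; apply: le_trans (nsqD_le _ _) _.
have := HM x; have := HN x; rewrite nsqZ => hN hM.
have := ler_wpM2l (sqmod_ge0 a) hM; lra.
Qed.

(** With c = <x, y>, the number <x, c y> = |c|^2 is real, so the real Cauchy-Schwarz inequality for
    x and c y applies; one factor |c|^2 cancels. *)
Lemma sqmod_inner x y : sqmod (inner x y) <= nsq x * nsq y.
Proof.
pose c := inner x y; have := rinner_CS x (c *: y).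
rewrite nsqZ /rinner innerZr -/c.
have -> : complex.Re (c^*%C * c) = sqmod c.
  by case: c => a b; rewrite /sqmod /=; ring.
have [->|c0] := eqVneq (sqmod c) 0; first by rewrite mulr_ge0 ?nsq_ge0.
have {}c0 : 0 < sqmod c by rewrite lt_def c0 sqmod_ge0.
by rewrite expr2 mulrCA ler_pM2l.
Qed.

Lemma adj_exists X : bounded_ops H X ->
  exists Y, forall x y, inner (X x) y = inner x (Y y).
Proof.
move=> /bounded_opsP[lX [M M0 HM]].
have ex y : exists z, forall x, inner (X x) y = inner x z.
  apply: (@riesz _ _ _ (M * nsq y)) => [b u v|x].
    by rewrite lX innerDl innerZl.
  apply: le_trans (sqmod_inner _ _) _; rewrite mulrAC.
  by rewrite ler_wpM2r ?nsq_ge0.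
by have [Y HY] := choice ex; exists Y.
Qed.

Lemma adjP X : bounded_ops H X -> forall x y, inner (X x) y = inner x (adj X y).
Proof.
move=> /adj_exists ex.
exact: (@getPex _ [set Y | forall x y, inner (X x) y = inner x (Y y)] ex).
Qed.

Lemma adjPr X : bounded_ops H X -> forall x y, inner (adj X x) y = inner x (X y).
Proof. by move=> bX x y; rewrite inner_conj -adjP// -inner_conj. Qed.

Lemma adj_eq X Y : bounded_ops H X ->
  (forall x y, inner (X x) y = inner x (Y y)) -> adj X = Y.
Proof.
by move=> bX XY; apply/funext => y; apply: inner_extr => x; rewrite -adjP.
Qed.

Lemma adj_linear X : bounded_ops H X -> linear (adj X).
Proof.
move=> bX b x y; apply: inner_extr => z.
by rewrite -adjP// !innerDr !innerZr !adjP.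
Qed.

(** From |X^* x|^4 = <X X^* x, x>^2 <= M |X^* x|^2 |x|^2: the bound of X serves for its adjoint. *)
Lemma bounded_adj X : bounded_ops H X -> bounded_ops H (adj X).
Proof.
move=> bX; have /bounded_opsP[lX [M M0 HM]] := bX; apply/bounded_opsP.
split; [exact: adj_linear|exists M => // x].
have := HM (adj X x); have := rinner_CS (X (adj X x)) x.
rewrite {1}/rinner adjP// -/(rinner _ _) -/(nsq _).
set N := nsq (adj X x); have N0 : 0 <= N := nsq_ge0 _.
have x0 := nsq_ge0 x => le1 le2.
have [->|NN0] := eqVneq N 0; first exact: mulr_ge0.
have {}N0 : 0 < N by rewrite lt_def NN0.
rewrite -(ler_pM2r N0) -expr2; apply: le_trans le1 _.
by rewrite mulrAC ler_wpM2r.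
Qed.

Lemma adjK X : bounded_ops H X -> adj (adj X) = X.
Proof.
move=> bX; apply: adj_eq; first exact: bounded_adj.
by move=> x y; rewrite adjPr.
Qed.

Lemma adj_id : adj idfun = idfun :> (H -> H).
Proof. by apply: adj_eq => //; exact: bounded_id. Qed.

Lemma adj_comp X Y : bounded_ops H X -> bounded_ops H Y ->
  adj (X \o Y) = adj Y \o adj X.
Proof.
move=> bX bY; apply: adj_eq; first exact: bounded_comp.
by move=> x y /=; rewrite !adjP.
Qed.

End BoundedOperators.

(** * Generated operator algebras *)

Section Algebras.
Context (R : realType) (H : hilbertType R).
Implicit Types (X Y Z : H -> H) (G A : set (H -> H)).

Lemma unital_bounded_ops : unital_subalgebra (bounded_ops H).
Proof.
split; last exact: bounded_comp; last exact: bounded_id.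
by split=> // *; [exact: bounded_0|exact: bounded_comb].
Qed.

(** Unital subalgebras are stable under intersection; that [bounded_ops] itself belongs to the class
    keeps the intersection inside the bounded operators. *)
Lemma unital_smallest (C : set (set (H -> H))) G :
  (forall A, C A -> unital_subalgebra A) -> C (bounded_ops H) ->
  G `<=` bounded_ops H -> unital_subalgebra (smallest C G).
Proof.
move=> Cu Cb Gb; split; first split.
- exact: smallest_sub.
- by move=> A [/Cu[[]]].
- move=> a X Y XA YA A [CA GA]; have [[_ _ HA] _ _] := Cu _ CA.
  by apply: HA; [apply: XA|apply: YA].
- by move=> A [/Cu[]].
- move=> X Y XA YA A [CA GA]; have [_ _ HA] := Cu _ CA.
  by apply: HA; [apply: XA|apply: YA].
Qed.

Lemma unital_sub A : unital_subalgebra A -> A `<=` bounded_ops H.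
Proof. by case=> -[]. Qed.

Lemma unital_comp A X Y : unital_subalgebra A -> A X -> A Y -> A (X \o Y).
Proof. by case=> _ _; apply. Qed.

Lemma unital_comb A a X Y : unital_subalgebra A -> A X -> A Y -> A (a *: X + Y).
Proof. by case=> -[_ _ h] _ _; exact: h. Qed.

Lemma unital_word n (T : gen n -> H -> H) A (w : word n) :
  unital_subalgebra A -> (forall i, A (T i)) -> A (word_op T w).
Proof.
move=> uA AT; elim: w => [|i w IHw] /=; first by case: uA.
exact: unital_comp.
Qed.

Lemma unital_eval n (T : gen n -> H -> H) A (p : free_algebra R n) :
  unital_subalgebra A -> (forall i, A (T i)) -> A (eval_op T p).
Proof.
move=> uA AT; rewrite /eval_op; elim/big_ind: _.
- by case: uA => -[].
- by move=> X Y AX AY; rewrite -[X]scale1r; exact: unital_comb.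
- move=> w _; rewrite -[_ *: _]addr0; apply: unital_comb => //.
    exact: unital_word.
  by case: uA => -[].
Qed.

Lemma bounded_word n (T : gen n -> H -> H) (w : word n) :
  (forall i, bounded_ops H (T i)) -> bounded_ops H (word_op T w).
Proof. exact: unital_word unital_bounded_ops. Qed.

Lemma Cstar_unital G : G `<=` bounded_ops H -> unital_subalgebra (Cstar_algebra G).
Proof.
move=> Gb; apply: unital_smallest => // [A []//|].
by split=> // *; [exact: unital_bounded_ops|exact: bounded_adj].
Qed.

Lemma Cstar_adj G X : Cstar_algebra G X -> Cstar_algebra G (adj X).
Proof. by move=> XG A CA; have [[_ _ aA] _] := CA; exact: aA (XG A CA). Qed.

Lemma Cstar_closed G : norm_closed (Cstar_algebra G).
Proof.
move=> X bX XG A CA; have [[_ nA _] _] := CA; apply: nA => // e e0.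
by have [Y YG HY] := XG e e0; exists Y => //; exact: YG A CA.
Qed.

End Algebras.

Section Projection.
Context (R : realType) (H : hilbertType R) (M : set H).

(** The functional y |-> <y, x> is bounded on the Hilbert space [perp M], and its Riesz vector there
    is the projection of x. *)
Lemma projP (x : H) (y : perp M) :
  inner (x - val (Defs.proj M x)) (val y) = 0.
Proof.
pose Q := [set z : perp M | forall y : perp M, inner (x - val z) (val y) = 0].
suff ex : exists z, Q z by exact: (@getPex _ Q ex).
have [z Hz] : exists z : perp M, forall y : perp M, inner (val y) x = inner y z.
  apply: (@riesz _ _ _ (nsq x)) => [b u v|u].
    by rewrite linearP innerDl innerZl.
  by rewrite mulrC; exact: sqmod_inner.
exists z => u; rewrite innerBl inner_conj Hz -inner_conj inner_perpE subrr //.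
Qed.

Lemma proj_inner (x : H) (y : perp M) : inner (Defs.proj M x) y = inner x (val y).
Proof.
by apply/eqP; rewrite inner_perpE eq_sym -subr_eq0 -innerBl projP.
Qed.

End Projection.

(** * The multiplicative domain *)

Lemma lec0_ReIm (R : realType) (z : R[i]) :
  0 <= z -> 0 <= complex.Re z /\ complex.Im z = 0.
Proof. by rewrite lecE /= => /andP[/eqP-> ->]. Qed.

Lemma lec_eps_eq0 (R : realType) (z : R[i]) :
  (forall e : R, 0 < e -> `|z| < e%:C) -> z = 0.
Proof.
move=> h; apply/eqP; rewrite -normr_eq0 eq_le normr_ge0 andbT.
have /complex_realP[t tE] : `|z| \is Num.real by rewrite normr_real.
rewrite tE lecR; apply/ler_addgt0Pl => e /h; rewrite tE ltcR addr0; exact: ltW.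
Qed.

Lemma le0_eps (R : realType) (a k : R) : 0 <= k ->
  (forall e, 0 < e -> a <= e ^+ 2 * k) -> a <= 0.
Proof.
move=> k0 h; apply/ler_addgt0Pl => e e0; rewrite addr0.
have k1 : 0 < k + 1 by rewrite ltr_wpDl.
have ek : 0 < e / (k + 1) by rewrite divr_gt0.
have := h (Num.sqrt (e / (k + 1))); rewrite sqrtr_gt0 => /(_ ek).
rewrite sqr_sqrtr ?(ltW ek)// => /le_trans; apply.
by rewrite mulrAC ler_pdivrMr// ler_wpM2l ?lerDl// ltW.
Qed.

Section UnitalCompletelyPositive.
Context (R : realType) (K H : hilbertType R).
Context (A : set (K -> K)) (mu : (K -> K) -> H -> H).
Hypothesis uA : unital_subalgebra A.
Hypothesis aA : forall X, A X -> A (adj X).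
Hypothesis cp : unital_cp_map A mu.
Implicit Types (X Y : K -> K) (x y z : H).

Let bA X : A X -> bounded_ops K X.
Proof. exact: unital_sub. Qed.

Let cA X Y : A X -> A Y -> A (X \o Y).
Proof. exact: unital_comp. Qed.

Let iA : A idfun.
Proof. by case: uA. Qed.

Lemma ucp_bounded X : A X -> bounded_ops H (mu X).
Proof. by case: cp => h _ _ _; exact: h. Qed.

Lemma ucp_comb a X Y : A X -> A Y -> mu (a *: X + Y) = a *: mu X + mu Y.
Proof. by case: cp => _ h _ _; exact: h. Qed.

Lemma ucp_id : mu idfun = idfun.
Proof. by case: cp. Qed.

(** The matrix of the Y_i^* Y_j is positive: its form at z is the squared norm of sum_j Y_j z_j. *)
Lemma ucp_gram m (Y : 'I_m -> K -> K) (x : 'I_m -> H) : (forall i, A (Y i)) ->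
  0 <= \sum_i \sum_j inner (mu (adj (Y i) \o Y j) (x j)) (x i).
Proof.
move=> AY; case: cp => _ _ _; apply=> [i j|z]; first by apply: cA => //; exact: aA.
rewrite (_ : \sum_i _ = inner (\sum_j Y j (z j)) (\sum_i Y i (z i))).
  exact: inner_ge0.
rewrite inner_sumr; apply: eq_bigr => i _.
rewrite inner_suml; apply: eq_bigr => j _ /=.
by rewrite adjPr//; exact: bA.
Qed.

Lemma ucp_pos X : A X -> (forall u, 0 <= inner (X u) u) ->
  forall x, 0 <= inner (mu X x) x.
Proof.
move=> AX X0 x; have [_ _ _ h] := cp.
have P : positive_opmx (fun _ _ : 'I_1 => X) by move=> z; rewrite !big_ord1.
by have := h 1%N _ (fun _ _ => AX) P (fun=> x); rewrite !big_ord1.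
Qed.

Lemma ucp_gram2 X x y : A X ->
  0 <= inner x x + inner (mu X y) x +
       (inner (mu (adj X) x) y + inner (mu (adj X \o X) y) y).
Proof.
move=> AX.
pose Y (i : 'I_2) := if val i is 0%N then idfun else X.
pose v (i : 'I_2) := if val i is 0%N then x else y.
have AY i : A (Y i) by case: i => -[].
have := ucp_gram v AY.
by rewrite !big_ord_recl !big_ord0 /= !addr0 /Y /v /= adj_id ucp_id.
Qed.

(** A nonnegative complex number is real. Reading off the imaginary part of the Gram form of (1, X)
    at (x, y) and at (i x, y) gives the imaginary and the real part of w = z^* . *)
Lemma ucp_adj X : A X -> mu (adj X) = adj (mu X).
Proof.
move=> AX; apply/esym/adj_eq; first exact: ucp_bounded.
move=> y x; set z := inner (mu X y) x; pose w := inner (mu (adj X) x) y.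
suff wz : w = z^*%C by rewrite inner_conj -/w wz conjcK.
have Axx : A (adj X \o X) by apply: cA => //; exact: aA.
have pos u : 0 <= inner (mu (adj X \o X) u) u.
  by apply: ucp_pos => // v /=; rewrite adjPr ?inner_ge0//; exact: bA.
have [_ h1] := lec0_ReIm (ucp_gram2 x y AX).
have [_ h2] := lec0_ReIm (ucp_gram2 ('i *: x) y AX).
have [_ h3] := lec0_ReIm (pos y).
have bX : bounded_ops H (mu (adj X)) by apply: ucp_bounded; exact: aA.
have lX := bX.1.
move: h1 h2; rewrite (op_linearZ _ _ lX) !innerZr !innerZl -/w -/z !nsqE !raddfD /= h3.
move: z w => [a b] [c d] /= h1 h2.
by apply/eqP; rewrite eq_complex /=; apply/andP; split; apply/eqP; lra.
Qed.

(** Kadison's inequality: the Gram form of (1, X), with first vector - mu(X) x, which minimizes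
    it. *)
Lemma ucp_schwarz X x : A X -> nsq (mu X x) <= rinner (mu (adj X \o X) x) x.
Proof.
move=> AX; have [+ _] := lec0_ReIm (ucp_gram2 (- mu X x) x AX).
rewrite ucp_adj// adjPr; last exact: ucp_bounded.
rewrite !raddfD /= -!/(rinner _ _) !(rinnerNl, rinnerNr) -!/(nsq _); lra.
Qed.

Lemma ucp_0 : mu 0 = 0.
Proof.
have := ucp_comb (-1) iA iA; rewrite ucp_id.
have E (V : lmodType R[i]) (u : V) : (-1) *: u + u = 0.
  by rewrite scaleN1r addrC subrr.
by rewrite !E.
Qed.

Lemma ucp_sub X Y x : A X -> A Y -> mu ((-1) *: Y + X) x = mu X x - mu Y x.
Proof.
move=> AX AY; rewrite ucp_comb// -[LHS]/((-1) *: mu Y x + mu X x).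
by rewrite scaleN1r addrC.
Qed.

(** Kadison's inequality combined with positivity of [mu] on c - X^* X. *)
Lemma ucp_contractive X (c : R) : A X -> (forall u, nsq (X u) <= c * nsq u) ->
  forall x, nsq (mu X x) <= c * nsq x.
Proof.
move=> AX Xc x; apply: le_trans (ucp_schwarz _ AX) _.
have Axx : A (adj X \o X) by apply: cA => //; exact: aA.
have A0 : A 0 by case: uA => -[].
pose W := (-1) *: (adj X \o X) + (c%:C *: idfun + 0).
have AW : A W by do 2?[apply: unital_comb => //].
have /(_ AW) W0 := @ucp_pos W.
have : 0 <= inner (mu W x) x.
  apply: W0 => z; have -> : W z = c%:C *: z - adj X (X z).
    by rewrite -[LHS]/((-1) *: adj X (X z) + (c%:C *: z + 0)) addr0 scaleN1r addrC.
  rewrite innerBl adjPr; last exact: bA.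
  by rewrite innerZl !nsqE -rmorphM -rmorphB ler0c subr_ge0.
rewrite /W ucp_comb//; last exact: (unital_comb _ uA).
rewrite ucp_comb// ucp_0 ucp_id => /lec0_ReIm[+ _].
rewrite -[(_ + _) x]/((-1) *: mu (adj X \o X) x + (c%:C *: x + 0)).
rewrite addr0 innerDl !innerZl nsqE -rmorphM raddfD /= mulN1r raddfN /=.
by rewrite addrC subr_ge0.
Qed.

(** The square |mu(a)^* y|^2 is added and subtracted so that the last bracket vanishes as soon as
    mu(a a^* ) = mu(a) mu(a)^* . *)
Lemma ucp_gram3 a X x y z : A a -> A X ->
  0 <= nsq x + nsq (adj (mu a) y) + rinner (mu (adj X \o X) z) z
     + 2 * rinner (adj (mu a) y) x + 2 * rinner (mu X z) x
     + 2 * rinner (mu (a \o X) z) y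
     + (rinner (mu (a \o adj a) y) y - nsq (adj (mu a) y)).
Proof.
move=> Aa AX; have Aa' := aA Aa.
pose Y (i : 'I_3) := match val i with 0%N => idfun | 1%N => adj a | _ => X end.
pose v (i : 'I_3) := match val i with 0%N => x | 1%N => y | _ => z end.
have AY i : A (Y i) by case: i => -[|[|[]]].
have := ucp_gram v AY.
rewrite !big_ord_recl !big_ord0 /= !addr0 /Y /v /= adj_id ucp_id adjK; last exact: bA.
have -> : adj X \o adj a = adj (a \o X) by rewrite adj_comp//; exact: bA.
have -> : mu (idfun \o adj a) = adj (mu a) by rewrite -ucp_adj.
rewrite -[a \o idfun]/a -[idfun \o X]/X -[adj X \o idfun]/(adj X).
have AaX : A (a \o X) by exact: cA.
rewrite !ucp_adj// => /lec0_ReIm[+ _].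
rewrite !raddfD /= -!/(rinner _ _) -/(nsq _).
have E b u w : A b -> rinner (adj (mu b) u) w = rinner (mu b w) u.
  by move=> Ab; rewrite /rinner adjPr -1?/(rinner _ _) 1?rinnerC//; exact: ucp_bounded.
rewrite (E X)// (E (a \o X))//.
have -> : rinner (mu a x) y = rinner (adj (mu a) y) x by rewrite E.
lra.
Qed.

(* Choi's multiplicative domain argument: expand the positivity of the Gram
   matrix of [1, a^*, X], with the first vector chosen to make it smallest. *)
Lemma ucp_multiplicative a : A a -> mu (a \o adj a) = mu a \o adj (mu a) ->
  forall X, A X -> mu (a \o X) = mu a \o mu X.
Proof.
move=> Aa mua X AX; apply/funext => z /=; have ba := ucp_bounded Aa.
set w := mu (a \o X) z; set d := w - mu a (mu X z).
suff d0 : nsq d = 0 by move/nsq_eq0/eqP: d0; rewrite subr_eq0 => /eqP.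
pose k := rinner (mu (adj X \o X) z) z.
(* Take y = - t d and first vector -(mu(a)^* y + mu(X) z). By [mua] the terms quadratic in t cancel,
   leaving an inequality affine in t; its validity for all t forces d = 0. *)
have h (t : R) : 2 * t * nsq d <= k.
  pose y := (- t)%:C *: d.
  have := ucp_gram3 (- (adj (mu a) y + mu X z)) y z Aa AX.
  rewrite nsqN mua /= -/w -/k -/(rinner _ _).
  have -> : rinner (mu a (adj (mu a) y)) y = nsq (adj (mu a) y).
    by rewrite /rinner adjP.
  have : rinner (adj (mu a) y) (mu X z) = rinner y (mu a (mu X z)).
    by rewrite /rinner adjPr.
  set p := adj (mu a) y; set q := mu X z => h1.
  have hd : nsq d = rinner d w - rinner d (mu a q).
    by rewrite /nsq {2}/d rinnerDr rinnerNr.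
  rewrite nsqD !rinnerNr !rinnerDr -!/(nsq _) (rinnerC q p) h1 /y.
  rewrite !rinnerZl rinnerZr (rinnerC w) hd.
  have := nsq_ge0 q; lra.
have [//|d0] := eqVneq (nsq d) 0.
have {}d0 : 0 < nsq d by rewrite lt_def d0 nsq_ge0.
(* This t makes the left-hand side equal to k + 1. *)
have := h ((k + 1) / (2 * nsq d)).
rewrite (_ : 2 * _ * _ = k + 1); first lra.
by field; rewrite gt_eqF.
Qed.

End UnitalCompletelyPositive.

Section PoissonOfMultiplicative.
Context (R : realType) (K H : hilbertType R).

(** The elements of C on whose left multiplication [mu] is multiplicative form a norm closed unital
    algebra, not assumed selfadjoint; Choi's argument puts G in it, hence the whole norm closed
    algebra. *)
Lemma poisson_of_multiplicative (G : set (K -> K)) (mu : (K -> K) -> H -> H) :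
  G `<=` bounded_ops K -> unital_cp_map (Cstar_algebra G) mu ->
  (forall X, G X -> mu (X \o adj X) = mu X \o adj (mu X)) ->
  poisson_transform G mu.
Proof.
move=> Gb cp Gmu; split=> // a b c aG bG cG.
set C := Cstar_algebra G.
have uC : unital_subalgebra C := Cstar_unital Gb.
have aC X : C X -> C (adj X) := @Cstar_adj _ _ G X.
pose D := [set X | C X /\ forall Y, C Y -> mu (X \o Y) = mu X \o mu Y].
have GC : G `<=` C by move=> X GX B [_ GB]; exact: GB.
have GD : G `<=` D.
  move=> X GX; split; first exact: GC.
  by apply: (ucp_multiplicative uC aC cp); [exact: GC|exact: Gmu].
have DC : D `<=` C by move=> X [].
have uD : unital_subalgebra D.
  split; first split.
  - by move=> X /DC; exact: unital_sub.
  - split; first by case: uC => -[].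
    by move=> Y CY; rewrite (ucp_0 uC cp).
  - move=> t X Y [CX HX] [CY HY]; split; first exact: (unital_comb _ uC).
    move=> Z CZ; have CXZ := unital_comp uC CX CZ; have CYZ := unital_comp uC CY CZ.
    have -> : (t *: X + Y) \o Z = t *: (X \o Z) + (Y \o Z) by [].
    by rewrite !(ucp_comb cp)// HX// HY.
  - split; first by case: uC.
    by move=> Y CY; rewrite (ucp_id cp).
  - move=> X Y [CX HX] [CY HY]; split; first exact: (unital_comp uC).
    move=> Z CZ; rewrite -compA HX; last exact: (unital_comp uC).
    by rewrite HY// compA -HX.
have nD : norm_closed D.
  move=> X bX HX.
  have CX : C X.
    apply: Cstar_closed => // e e0; have [Y [CY _] HY] := HX e e0.
    by exists Y.
  split=> // Y CY; apply/funext => x /=.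
  apply/eqP; rewrite -subr_eq0; apply/eqP/nsq_eq0.
  have /bounded_opsP[lY [M M0 HM]] := unital_sub uC CY.
  set d := _ - _.
  (* Replace X by a nearby Z in [D]: with W = X - Z, the error is mu(W Y) x - mu(W) (mu(Y) x), and
     contractivity of [mu] controls both terms by e^2. *)
  have h e : 0 < e -> nsq d <= e ^+ 2 * (2 * (M * nsq x) + 2 * nsq (mu Y x)).
    move=> e0; have [Z [CZ HZ] XZ] := HX e e0.
    pose W := (-1) *: Z + X.
    have WE y : W y = X y - Z y.
      by rewrite addrC -[LHS]/((-1) *: Z y + X y) scaleN1r addrC.
    have CW : C W by exact: (unital_comb _ uC).
    have We y : nsq (W y) <= e ^+ 2 * nsq y.
      by rewrite WE -norm_le_nsq ?(ltW e0) ?XZ.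
    have -> : d = mu (W \o Y) x - mu W (mu Y x).
      have -> : W \o Y = (-1) *: (Z \o Y) + (X \o Y) by [].
      rewrite !(ucp_sub cp)//; try exact: (unital_comp uC).
      by rewrite HZ //= /d opprB addrA subrK.
    apply: le_trans (nsqD_le _ _) _; rewrite nsqN.
    have CWY : C (W \o Y) by exact: (unital_comp uC).
    have := ucp_contractive uC aC cp CW We (mu Y x).
    have WYe y : nsq ((W \o Y) y) <= e ^+ 2 * M * nsq y.
      by apply: le_trans (We _) _; rewrite -mulrA ler_wpM2l ?sqr_ge0.
    have := ucp_contractive uC aC cp CWY WYe x.
    lra.
  set k := 2 * _ + 2 * _ in h.
  have k0 : 0 <= k by rewrite addr_ge0 ?mulr_ge0 ?nsq_ge0.
  by apply/le_anti; rewrite nsq_ge0 andbT (le0_eps k0 h).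
have AD : norm_closed_algebra G `<=` D by exact: smallest_sub.
have [Ca Ha] := AD _ aG; have [Cb _] := AD _ bG; have [Cc _] := AD _ cG.
by apply: Ha; apply: (unital_comp uC) => //; exact: aC.
Qed.

End PoissonOfMultiplicative.

(** * The Fock space and the constrained shifts *)

Section Esum.
Context (R : realType).
Local Open Scope ereal_scope.

Lemma esum_ge_seq (I : choiceType) (F : I -> \bar R) (s : seq I) : uniq s ->
  \sum_(i <- s) F i <= \esum_(i in [set: I]) F i.
Proof.
move=> us; apply: esum_ge; exists [set` s].
  by split => //; exact: finite_seq.
by rewrite -fsbig_seq.
Qed.

Lemma esum_le_seq (I : choiceType) (F : I -> \bar R) (M : \bar R) :
  (forall s : seq I, uniq s -> \sum_(i <- s) F i <= M) ->
  \esum_(i in [set: I]) F i <= M.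
Proof.
move=> FM; apply: ge_ereal_sup => _ [X [finX _] <-].
by rewrite fsbig_finite//= FM// fset_uniq.
Qed.

(** Both sides are suprema of finite sums. [sumR] underlies the inner product, while [esum] can be
    reindexed over words. *)
Lemma esum_sumR (I : countType) (F : I -> R) (M : R) : (forall i, 0 <= F i)%R ->
  (forall s, uniq s -> \sum_(i <- s) F i <= M)%R ->
  \esum_(i in [set: I]) (F i)%:E = (sumR F)%:E.
Proof.
move=> F0 FM; have [cF FM'] := sumR_bounded F0 FM.
apply/le_anti/andP; split.
  by apply: esum_le_seq => s us; rewrite sumEFin lee_fin ler_sumR.
have fin : \esum_(i in [set: I]) (F i)%:E \is a fin_num.
  rewrite ge0_fin_numE; last by apply: esum_ge0 => i _; rewrite lee_fin.
  apply: (@le_lt_trans _ _ M%:E); last by rewrite ltry.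
  by apply: esum_le_seq => s us; rewrite sumEFin lee_fin FM.
rewrite -(fineK fin) lee_fin.
have [] // := @sumR_bounded _ _ F (fine (\esum_(i in [set: I]) (F i)%:E)) F0 _.
by move=> s us; rewrite -lee_fin fineK// -sumEFin esum_ge_seq.
Qed.

Lemma esum_consD (T : choiceType) (i : T) (F : seq T -> \bar R) : (forall w, 0 <= F w) ->
  \esum_(w in [set: seq T]) F w =
  \esum_(a in [set: seq T]) F (i :: a) + \esum_(w in ~` range (cons i)) F w.
Proof.
move=> F0; rewrite (esumID (range (cons i)))// !setTI; congr (_ + _).
apply: reindex_esum; split.
- by move=> a _; exists a.
- by move=> a b _ _ [].
- by move=> _ [a _ <-]; exists a.
Qed.

(** A word is empty or has a first letter and a tail; this recursion drives the telescoping of the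
    defects. *)
Lemma esum_word (T : choiceType) (F : seq T -> \bar R) : (forall w, 0 <= F w) ->
  \esum_(w in [set: seq T]) F w =
  F [::] + \esum_(i in [set: T]) \esum_(a in [set: seq T]) F (i :: a).
Proof.
move=> F0; rewrite (esumID [set [::]])// !setTI esum_set1//; congr (_ + _).
rewrite (@esum_esum _ _ _ _ (fun=> setT))//.
apply: reindex_esum; split.
- by move=> [i a] _.
- by move=> [i a] [j b] _ _ [-> ->].
- by move=> [|i a] //= _; exists (i, a).
Qed.

End Esum.

Section SquareSummableNorm.
Context (R : realType) (I : countType).
Implicit Types f g : l2 R I.

Lemma l2_ext f g : (forall i, l2_val f i = l2_val g i) -> f = g.
Proof. by move=> fg; apply: val_inj; apply/funext. Qed.

Lemma l2_combE a f g i :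
  l2_val (a *: f + g) i = a * l2_val f i + l2_val g i.
Proof. by []. Qed.

Lemma l2_addE f g i :
  l2_val (f + g) i = l2_val f i + l2_val g i.
Proof. by []. Qed.

Lemma l2_nsq f :
  (\esum_(i in [set: I]) (sqmod (l2_val f i))%:E)%E = (nsq f)%:E.
Proof.
rewrite /nsq /rinner -[inner f f]/(l2_inner f f) l2_inner_sqmod /=.
by have /l2P[M HM] := valP f; apply: esum_sumR HM => i; exact: sqmod_ge0.
Qed.

End SquareSummableNorm.

Section Fock.
Context (R : realType) (n : option nat).
Notation F := (fock R n).
Notation S := (@creation R n).
Implicit Types (f g : F) (i : gen n).

Lemma tail_l2 i f : (fun a => l2_val f (i :: a)) \in @l2_pred R (word n).
Proof.
have /l2P[M HM] := valP f; apply/l2P; exists M => s us.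
rewrite -(big_map (cons i) xpredT (fun w => sqmod (l2_val f w))).
by apply: HM; rewrite map_inj_uniq// => a b [].
Qed.

(** The adjoint S_i^* in coordinates. *)
Definition tail i f : F := L2 (tail_l2 i f).

Lemma creation_linear i : linear (S i).
Proof.
move=> a f g; apply: l2_ext => w; rewrite l2_combE /=.
by case: w => [|j v] /=; [|case: eqP => _]; rewrite ?l2_combE// mulr0 addr0.
Qed.

Lemma tail_linear i : linear (tail i).
Proof. by move=> a f g; apply: l2_ext. Qed.

(** Polarization avoids handling the series of the inner product: coordinates at words starting with
    i and the others split the squared norm, and S_i f lives on the former only. Thus |S_i f + g|^2
    and |f + tail g|^2 differ by the rest of g, and expanding leaves the cross terms. *)
Lemma rinner_creation i f g : rinner (S i f) g = rinner f (tail i g).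
Proof.
pose rest (h : F) : \bar R := (\esum_(w in ~` range (cons i)) (sqmod (l2_val h w))%:E)%E.
have split_nsq h : (nsq h)%:E = ((nsq (tail i h))%:E + rest h)%E.
  rewrite -!l2_nsq (esum_consD i)// => w; rewrite lee_fin; exact: sqmod_ge0.
have fin h : rest h \is a fin_num.
  have := split_nsq h; case: (rest h) => //.
have split_nsq' h : nsq h = nsq (tail i h) + fine (rest h).
  by apply: EFin_inj; rewrite split_nsq EFinD fineK.
have tailS h : tail i (S i h) = h.
  by apply: l2_ext => a /=; rewrite eqxx.
have offS h w : ~ range (cons i) w -> l2_val (S i h) w = 0.
  case: w => [//|j a] /=; case: eqP => // -> ni; exfalso; apply: ni.
  by exists a.
have restS h : rest (S i h) = 0%E.
  by apply: esum1 => w /offS ->; rewrite /sqmod /= expr0n addr0.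
have restD : rest (S i f + g) = rest g.
  by apply: eq_esum => w /offS w0; rewrite l2_addE w0 add0r.
have nS : nsq (S i f) = nsq f by rewrite split_nsq' restS tailS addr0.
have tailD : tail i (S i f + g) = f + tail i g.
  by have := tail_linear i 1 (S i f) g; rewrite !scale1r tailS.
have := nsqD (S i f) g; have := nsqD f (tail i g).
rewrite (split_nsq' (S i f + g)) restD tailD (split_nsq' g) nS; lra.
Qed.

Lemma inner_creation i f g : inner (S i f) g = inner f (tail i g).
Proof.
rewrite !innerE !rinner_creation.
have -> // : tail i ('i *: g) = 'i *: tail i g.
exact: op_linearZ (tail_linear i).
Qed.

(** The coordinate at the empty word is what sum_i S_i S_i^* misses from the identity. *)
Lemma nsq_tail_sum (s : seq (gen n)) f : uniq s ->
  \sum_(i <- s) nsq (tail i f) <= nsq f.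
Proof.
move=> us; rewrite -lee_fin -sumEFin -[leRHS]l2_nsq esum_word; last first.
  by move=> w; rewrite lee_fin sqmod_ge0.
rewrite (_ : (\esum_(i in [set: gen n]) _)%E =
    (\esum_(i in [set: gen n]) (nsq (tail i f))%:E)%E); last first.
  by apply: eq_esum => i _; exact: (l2_nsq (tail i f)).
apply: (le_trans (esum_ge_seq (fun i => (nsq (tail i f))%:E) us)).
by rewrite leeDr// lee_fin sqmod_ge0.
Qed.

Lemma tail_creation i f : tail i (S i f) = f.
Proof. by apply: l2_ext => a /=; rewrite eqxx. Qed.

Lemma bounded_creation i : bounded_ops F (S i).
Proof.
apply/bounded_opsP; split; first exact: creation_linear.
by exists 1 => // f; rewrite mul1r {1}/nsq rinner_creation tail_creation.
Qed.

Lemma creation_bounded : range S `<=` bounded_ops F.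
Proof. by move=> _ [i _ <-]; exact: bounded_creation. Qed.

Lemma Finfty_unital : unital_subalgebra (@Finfty R n).
Proof.
apply: unital_smallest creation_bounded => [A []//|].
by split; first exact: unital_bounded_ops.
Qed.

Lemma Finfty_creation i : Finfty (S i).
Proof. by move=> A [_ SA]; apply: SA; exists i. Qed.

Lemma Finfty_closed : wot_closed (@Finfty R n).
Proof.
move=> X bX XF A CA; have [[_ wA] _] := CA; apply: wA => // e s e0.
by have [Y YF HY] := XF e s e0; exists Y => //; exact: YF A CA.
Qed.

End Fock.

Section ProjectedOperators.
Context (R : realType) (H : hilbertType R) (M : set H).

Lemma proj_linear a (x y : H) :
  Defs.proj M (a *: x + y) = a *: Defs.proj M x + Defs.proj M y.
Proof.
by apply: inner_extl => z; rewrite innerDl innerZl !proj_inner innerDl innerZl.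
Qed.

Lemma nsq_proj x : nsq (Defs.proj M x) <= nsq x.
Proof.
have : nsq (Defs.proj M x) = rinner x (val (Defs.proj M x)).
  by rewrite {1}/nsq {1}/rinner proj_inner.
have := nsq_ge0 (x - val (Defs.proj M x)); rewrite nsqB.
have : nsq (val (Defs.proj M x)) = nsq (Defs.proj M x) by [].
lra.
Qed.

Lemma proj_eq0 x : (forall y : perp M, inner x (val y) = 0) -> Defs.proj M x = 0.
Proof.
by move=> x0; apply: inner_extl => y; rewrite proj_inner x0 inner0l.
Qed.

End ProjectedOperators.

(** * The compressed shifts on N_J *)

Section Constrained.
Context (R : realType) (n : option nat) (P : set (free_algebra R n)).
Notation F := (fock R n).
Notation S := (@creation R n).
Notation N := (NJ P).
Notation B := (@compressed_creation R n P).
Notation pr := (Defs.proj (ideal_range P)).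

Lemma ideal_eval p : P p -> ideal_of P (eval_op S p).
Proof. by move=> Pp A [_ PA]; apply: PA; exists p. Qed.

Lemma ideal_mull X Y : Finfty X -> ideal_of P Y -> ideal_of P (X \o Y).
Proof.
move=> FX JY A CA; have [[[_ _ h] _] _] := CA.
exact: (h X Y FX (JY A CA)).1.
Qed.

(** J is a left ideal, so S_i maps J F^2 into itself and S_i^* preserves its complement. *)
Lemma tail_NJ (y : N) i : tail i (val y) \in perp_pred (ideal_range P).
Proof.
apply/perpP => _ [X [f [JX ->]]]; rewrite inner_conj -inner_creation -inner_conj.
have /perpP -> // := valP y; exists (S i \o X), f; split=> //.
exact: ideal_mull (Finfty_creation _) JX.
Qed.

Lemma bounded_B i : bounded_ops N (B i).
Proof.
have /bounded_opsP[lS [c c0 Sc]] := @bounded_creation R n i.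
apply/bounded_opsP; split.
  by move=> a x y; rewrite /compressed_creation linearP lS proj_linear.
exists c => // x; apply: le_trans (nsq_proj _ _) _; exact: Sc.
Qed.

Lemma adj_B i (z : N) : adj (B i) z = pr (tail i (val z)).
Proof.
have -> // : adj (B i) = fun z => pr (tail i (val z)).
apply: adj_eq; first exact: bounded_B.
by move=> x y; rewrite proj_inner [RHS]inner_conj proj_inner -inner_conj inner_creation.
Qed.

Lemma B_row (s : seq (gen n)) (z : N) : uniq s ->
  \sum_(i <- s) nsq (adj (B i) z) <= nsq z.
Proof.
move=> us; apply: le_trans (nsq_tail_sum _ us).
by apply: ler_sum => i _; rewrite adj_B nsq_proj.
Qed.

(** Co-invariance of N_J gives P S_i P = P S_i, so compression is multiplicative on words. *)
Lemma B_proj i x : B i (pr x) = pr (S i x).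
Proof.
apply: inner_extl => y.
apply: (etrans (proj_inner (S i (val (pr x))) y)).
apply/esym; apply: (etrans (proj_inner (S i x) y)).
apply/esym; rewrite !inner_creation.
exact: (proj_inner x (Perp (tail_NJ y i))).
Qed.

Lemma word_B w (z : N) : word_op B w z = pr (word_op S w (val z)).
Proof.
elim: w => [|i w IHw].
  by apply: inner_extl => y; exact: (esym (proj_inner (val z) y)).
by rewrite -[LHS]/(B i (word_op B w z)) IHw; exact: B_proj.
Qed.

Lemma eval_B p : P p -> eval_op B p = 0.
Proof.
move=> Pp; apply/funext => z; rewrite /eval_op fct_sumE.
transitivity (pr (eval_op S p (val z))); last first.
  apply: proj_eq0 => y; have /perpP yJ := valP y.
  rewrite inner_conj yJ ?rmorph0//.
  by exists (eval_op S p), (val z); split => //; exact: ideal_eval.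
apply: inner_extl => y; apply: esym.
apply: (etrans (proj_inner (eval_op S p (val z)) y)).
rewrite /eval_op fct_sumE !inner_suml; apply: eq_bigr => w _.
rewrite -[RHS]/(inner (p w *: word_op B w z) y) word_B.
rewrite -[LHS]/(inner (p w *: word_op S w (val z)) (val y)).
rewrite !innerZl; congr (_ * _).
exact: (esym (proj_inner (word_op S w (val z)) y)).
Qed.

End Constrained.

(** * Poisson transforms and the row contractions implementing them *)

Section ImplementingRow.
Context (R : realType) (n : option nat) (H : hilbertType R).
Context (P : set (free_algebra R n)).
Notation N := (NJ P).
Notation B := (@compressed_creation R n P).
Notation C := (Cstar_algebra (range B)).
Context (mu : (N -> N) -> H -> H).
Hypothesis cp : unital_cp_map C mu.

Lemma range_B_bounded : range B `<=` bounded_ops N.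
Proof. by move=> _ [i _ <-]; exact: bounded_B. Qed.

Lemma Cstar_B_unital : unital_subalgebra C.
Proof. exact: Cstar_unital range_B_bounded. Qed.

Lemma Cstar_B i : C (B i).
Proof. by move=> A [_ BA]; apply: BA; exists i. Qed.

Lemma norm_B i : norm_closed_algebra (range B) (B i).
Proof. by move=> A [_ BA]; apply: BA; exists i. Qed.

Lemma norm_B_unital : unital_subalgebra (norm_closed_algebra (range B)).
Proof.
apply: unital_smallest range_B_bounded => [A []//|].
by split=> //; exact: unital_bounded_ops.
Qed.

Let uC := Cstar_B_unital.
Let aC (X : N -> N) : C X -> C (adj X) := @Cstar_adj _ _ (range B) X.

Lemma ucp_sum (I : Type) (s : seq I) (c : I -> R[i]) (X : I -> N -> N) :
  (forall i, C (X i)) ->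
  C (\sum_(i <- s) c i *: X i) /\
  mu (\sum_(i <- s) c i *: X i) = \sum_(i <- s) c i *: mu (X i).
Proof.
move=> CX; elim: s => [|i s [IH1 IH2]].
  by rewrite !big_nil; split; [case: uC => -[]|exact: (ucp_0 uC cp)].
rewrite !big_cons; split; first exact: (unital_comb _ uC).
by rewrite (ucp_comb cp) // IH2.
Qed.

(** The row is T_i = mu(B_i). Choosing the identity as third or second factor in the product rule
    gives mu on words, and then on B_a B_b^* . *)
Lemma row_of_poisson : poisson_transform (range B) mu ->
  exists T : gen n -> H -> H,
    [/\ row_contraction T, forall p, P p -> eval_op T p = 0
      & forall a b : word n, mu (word_op B a \o adj (word_op B b)) =
                             word_op T a \o adj (word_op T b)].
Proof.
move=> [_ mul]; pose T i := mu (B i).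
have uN := norm_B_unital.
have iN : norm_closed_algebra (range B) idfun by case: uN.
have Nw w : norm_closed_algebra (range B) (word_op B w).
  by apply: (unital_word w uN) => i; exact: norm_B.
have Cw w : C (word_op B w) by apply: (unital_word w uC) => i; exact: Cstar_B.
have muw w : mu (word_op B w) = word_op T w.
  elim: w => [|i w IHw]; first exact: (ucp_id cp).
  have := mul _ _ _ (norm_B i) (Nw w) iN; rewrite adj_id => h.
  by rewrite -[LHS]/(mu (B i \o (word_op B w \o idfun))) h
    -[word_op B w \o idfun]/(word_op B w) IHw.
have muadj X : C X -> mu (adj X) = adj (mu X) by move=> CX; exact: (ucp_adj uC aC cp CX).
have muwa a b : mu (word_op B a \o adj (word_op B b)) = word_op T a \o adj (word_op T b).
  have := mul _ _ _ (Nw a) iN (Nw b).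
  by rewrite -[idfun \o adj _]/(adj (word_op B b)) muadj// !muw.
exists T; split=> //.
- have bT i : bounded_ops H (T i) by apply: (ucp_bounded cp); exact: Cstar_B.
  split=> // x; apply: esum_le_seq => s us; rewrite sumEFin lee_fin.
  pose X i := B i \o adj (B i).
  have CX i : C (X i) by apply: (unital_comp uC); [exact: Cstar_B|exact: aC (Cstar_B i)].
  have muX i : mu (X i) = T i \o adj (T i) := muwa [:: i] [:: i].
  have [CS muS] := ucp_sum s (fun=> 1) CX.
  (* W = 1 - sum over s of B_i B_i^* is positive by [B_row]; finite s suffice, and its image yields
     the row inequality for T. The scalars 1 only match the shape of [ucp_sum]. *)
  pose W := (-1) *: (\sum_(i <- s) 1 *: X i) + idfun.
  have CW : C W by apply: (unital_comb _ uC) => //; case: uC.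
  have WE z : W z = z - \sum_(i <- s) X i z.
    rewrite -[LHS]/((-1) *: (\sum_(i <- s) 1 *: X i) z + z) scaleN1r addrC fct_sumE.
    by congr (_ - _); apply: eq_bigr => i _; rewrite scale1r.
  have W0 z : 0 <= inner (W z) z.
    rewrite WE innerBl inner_suml nsqE.
    have -> : \sum_(i <- s) inner (X i z) z = (\sum_(i <- s) nsq (adj (B i) z))%:C.
      rewrite rmorph_sum; apply: eq_bigr => i _.
      by apply: etrans (nsqE (adj (B i) z)); exact: (adjP (@bounded_B _ _ P i)).
    by rewrite -rmorphB ler0c subr_ge0; exact: B_row.
  have [+ _] := lec0_ReIm (ucp_pos cp CW W0 x).
  rewrite (ucp_sub cp)//; last by case: uC.
  have muSx : (\sum_(i <- s) 1 *: mu (X i)) x = \sum_(i <- s) T i (adj (T i) x).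
    rewrite fct_sumE; apply: eq_bigr => i _.
    by rewrite -[LHS]/(1 *: mu (X i) x) scale1r muX.
  by rewrite (ucp_id cp) muS muSx innerBl inner_suml raddfB /= raddf_sum subr_ge0.
- move=> p Pp; rewrite -[RHS](ucp_0 uC cp) -(eval_B Pp) /eval_op.
  have [_ ->] := ucp_sum (finsupp p) p Cw.
  by apply: eq_bigr => w _; rewrite muw.
Qed.

(** Taking b empty identifies T_i with mu(B_i); taking a and b to be the letter i then gives Choi's
    hypothesis on the generators. *)
Lemma poisson_of_row (T : gen n -> H -> H) :
  (forall a b : word n, mu (word_op B a \o adj (word_op B b)) =
                        word_op T a \o adj (word_op T b)) ->
  poisson_transform (range B) mu.
Proof.
move=> muT; apply: (poisson_of_multiplicative range_B_bounded cp) => _ [i _ <-].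
have muB : mu (B i) = T i by have := muT [:: i] [::]; rewrite !adj_id.
have w1 (K : hilbertType R) (X : gen n -> K -> K) : word_op X [:: i] = X i by [].
have := muT [:: i] [:: i]; rewrite !w1 => h.
by apply: (etrans h); rewrite -muB.
Qed.

End ImplementingRow.

(** * Poisson kernels *)

Section PositiveForms.
Context (R : realType) (V : lmodType R[i]).
Implicit Types (D : V -> V -> R[i]).

(* Each step splits off the rank one form [D u v0 * (D v v0)^* / D v0 v0]; the
   remainder (Schur complement) is again positive and vanishes at [v0]. *)
Lemma form_finite_rank D (s : seq V) : (forall y, scalar (D^~ y)) ->
  (forall x y, D y x = (D x y)^*%C) -> (forall x, 0 <= D x x) ->
  exists m (lam : nat -> V -> R[i]),
    [/\ forall k, scalar (lam k),
        forall v, \sum_(k < m) sqmod (lam k v) <= complex.Re (D v v)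
      & forall v, v \in s -> complex.Re (D v v) <= \sum_(k < m) sqmod (lam k v)].
Proof.
elim: s D => [|v0 s IHs] D lin cnj ge0.
  exists 0%N, (fun _ _ => 0); split=> // [k a x y|v].
    by rewrite mulr0 addr0.
  by rewrite big_ord0; case: (lec0_ReIm (ge0 v)).
have real v : D v v = (complex.Re (D v v))%:C.
  by case: (lec0_ReIm (ge0 v)); case: (D v v) => a b /= _ ->.
set d := complex.Re (D v0 v0).
have [d0|dN0] := eqVneq d 0.
  have [m [lam [linl le ge]]] := IHs D lin cnj ge0.
  exists m, lam; split=> // v; rewrite inE => /predU1P[->|]; last exact: ge.
  by rewrite -/d d0 sumr_ge0// => k _; exact: sqmod_ge0.
have {dN0}d0 : 0 < d by rewrite lt_def dN0; case: (lec0_ReIm (ge0 v0)).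
pose D' u v := D u v - d^-1%:C * (D u v0 * (D v v0)^*%C).
have sq u : D u v0 * (D u v0)^*%C = (sqmod (D u v0))%:C.
  by case: (D u v0) => a b; apply/eqP; rewrite eq_complex /sqmod /=;
    apply/andP; split; apply/eqP; ring.
have D'E v : D' v v = (complex.Re (D v v) - d^-1 * sqmod (D v v0))%:C.
  by rewrite /D' sq real rmorphB rmorphM.
have [|||m [lam [linl le ge]]] := IHs D'.
- move=> y a u v; rewrite /D' !lin; ring.
- move=> x y; rewrite /D' rmorphB !rmorphM /= oppr0 conjcK -!cnj.
  rewrite -[d^-1 +i* 0]/(d^-1%:C); ring.
- move=> v; rewrite D'E ler0c.
  (* Positivity of the Schur complement: D evaluated at v minus its D-projection on v0. *)
  have := ge0 (v + (- (d^-1%:C * D v v0)) *: v0).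
  rewrite (form_Dl lin) !(form_Dr lin cnj) !(form_Zl lin) !(form_Zr lin cnj).
  rewrite (real v) (real v0) -/d (cnj v v0) => /lec0_ReIm[+ _].
  rewrite /sqmod; case: (D v v0) => a b /=.
  set t := complex.Re (D v v).
  rewrite [X in 0 <= X -> _](_ : _ = t - d^-1 * (a ^+ 2 + b ^+ 2))//.
  by field; rewrite gt_eqF.
have sqd0 : 0 < Num.sqrt d by rewrite sqrtr_gt0.
(* The split-off form is the square of D(., v0) / sqrt d, prepended as index 0; at v0 it alone gives
   d. *)
pose lam' k := if k is j.+1 then lam j else fun v => (Num.sqrt d)^-1%:C * D v v0.
have lam0 v : sqmod (lam' 0%N v) = d^-1 * sqmod (D v v0).
  rewrite sqmodM; congr (_ * _).
  by rewrite /sqmod /= expr0n addr0 exprVn sqr_sqrtr ?(ltW d0).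
have ReD' v : complex.Re (D' v v) = complex.Re (D v v) - d^-1 * sqmod (D v v0).
  by rewrite D'E.
exists m.+1, lam'; split.
- by case=> [|k] //= a u v; rewrite lin; ring.
- by move=> v; have := le v; rewrite big_ord_recl lam0 ReD'; lra.
- move=> v; rewrite inE big_ord_recl lam0 => /predU1P[->|/ge]; last by rewrite ReD'; lra.
  rewrite (_ : d^-1 * _ = d); first by rewrite lerDl sumr_ge0// => k _; exact: sqmod_ge0.
  by rewrite real -/d /sqmod /= expr0n addr0; field; rewrite gt_eqF.
Qed.

End PositiveForms.

(** * The defect form and its telescoping along words *)

Section DefectForm.
Context (R : realType) (I : countType) (H : hilbertType R).
Context (C : I -> H -> H) (r : R).
Hypothesis C_linear : forall i, linear (C i).
Hypothesis r01 : 0 <= r < 1.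
Hypothesis C_row : forall (s : seq I) x, uniq s ->
  \sum_(i <- s) nsq (C i x) <= r * nsq x.
Implicit Types (u v x y : H) (w : seq I).

Lemma cvg_dominated (F G : I -> R) (M : R) : (forall i, `|F i| <= G i) ->
  (forall s, uniq s -> \sum_(i <- s) G i <= M) -> cvgn (series (sum_term F)).
Proof.
move=> FG GM; have G0 i : 0 <= G i by apply: le_trans (FG i).
have [cG _] := sumR_bounded G0 GM.
apply: normed_cvg; apply: series_le_cvg cG => k //=.
  by rewrite /sum_term; case: pickle_inv => /=.
by rewrite /sum_term; case: pickle_inv => //=; rewrite normr0.
Qed.

Lemma summable_inner u v : summableC (fun i => inner (C i u) (C i v)).
Proof.
have bnd (z : H) (s : seq I) : uniq s -> \sum_(i <- s) nsq (C i z) <= nsq z.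
  move=> us; apply: le_trans (C_row _ us) _.
  by rewrite ler_piMl ?nsq_ge0//; case/andP: r01 => _ /ltW.
have dom (p : R[i] -> R) : (forall x y, `|p (inner x y)| <= nsq x + nsq y) ->
    cvgn (series (sum_term (fun i => p (inner (C i u) (C i v))))).
  move=> pP; apply: (@cvg_dominated _ (fun i => nsq (C i u) + nsq (C i v))
                                  (nsq u + nsq v)).
    by move=> i; exact: pP.
  by move=> s us; rewrite big_split /= lerD// bnd.
have re x y : `|rinner x y| <= nsq x + nsq y.
  rewrite ler_norml; have := nsq_ge0 (x + y); have := nsq_ge0 (x - y).
  have := nsq_ge0 x; have := nsq_ge0 y.
  by rewrite nsqB nsqD => *; apply/andP; split; lra.
split; apply: dom => x y; first exact: re.
rewrite innerE /=; have := re x ('i *: y).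
by rewrite nsqZ /sqmod /= expr0n expr1n add0r mul1r.
Qed.

Lemma sumRN (F : I -> R) : cvgn (series (sum_term F)) ->
  sumR (fun i => - F i) = - sumR F.
Proof.
(* The combination -2 F + 0 F + F is - F. *)
move=> cF; have := sumR_comb (-2) 0 cF cF cF.
rewrite (_ : (fun i => _) = fun i => - F i) => [->|]; first by ring.
by apply/funext => i; ring.
Qed.

(** The sesquilinear form of 1 - sum_i C_i^* C_i. *)
Definition defect u v := inner u v - sumC (fun i => inner (C i u) (C i v)).

Lemma defect_linear v : scalar (defect^~ v).
Proof.
move=> a x y; rewrite /defect innerDl innerZl.
rewrite (_ : sumC _ = a * sumC (fun i => inner (C i x) (C i v))
                      + sumC (fun i => inner (C i y) (C i v))); first by ring.
rewrite -sumC_linear; try exact: summable_inner.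
by apply: eq_sumC => i; rewrite C_linear innerDl innerZl.
Qed.

Lemma defect_conj u v : defect v u = (defect u v)^*%C.
Proof.
rewrite /defect rmorphB /= -inner_conj; congr (_ - _).
have [_ ci] := summable_inner u v.
rewrite /sumC /= -(sumRN ci); congr (_ +i* _).
  by apply: eq_sumR => i; rewrite inner_conj; case: (inner _ _).
by apply: eq_sumR => i; rewrite inner_conj; case: (inner _ _).
Qed.

Definition defect_sq u := nsq u - sumR (fun i => nsq (C i u)).

Lemma defectE u : defect u u = (defect_sq u)%:C.
Proof.
have := defect_conj u u; rewrite /defect nsqE /sumC /defect_sq => h.
apply/eqP; rewrite eq_complex /= eqxx /=; apply/eqP.
by move: h => [] /=; lra.
Qed.

Lemma defect_sq_ge0 u : 0 <= defect_sq u.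
Proof.
rewrite subr_ge0.
have [_] := @sumR_bounded _ _ (fun i => nsq (C i u)) (r * nsq u)
  (fun i => nsq_ge0 _) (fun s => @C_row s u).
move/le_trans; apply; rewrite ler_piMl ?nsq_ge0//.
by case/andP: r01 => _ /ltW.
Qed.

Lemma defect_ge0 u : 0 <= defect u u.
Proof. by rewrite defectE ler0c defect_sq_ge0. Qed.

(** The left fold lets the first letter act first, as in (T_i T_w)^* = T_w^* T_i^* . *)
Definition iterC w x := foldl (fun y i => C i y) x w.

Lemma iterC_linear w : linear (iterC w).
Proof.
elim: w => [|i w IHw] a x y //=.
by rewrite /iterC /= C_linear; exact: IHw.
Qed.

Local Open Scope ereal_scope.

Lemma esum_C u : \esum_(i in [set: I]) (nsq (C i u))%:E =
                 (sumR (fun i => nsq (C i u)))%:E.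
Proof. by apply: esum_sumR (fun s => @C_row s u) => i; exact: nsq_ge0. Qed.

Lemma defect_split u :
  (defect_sq u)%:E + \esum_(i in [set: I]) (nsq (C i u))%:E = (nsq u)%:E.
Proof. by rewrite esum_C -EFinD subrK. Qed.

(** Truncated to words shorter than N, the sum is bounded by induction on N through [defect_split];
    every finite set of words is covered by some N. *)
Lemma defect_esum_le u :
  \esum_(w in [set: seq I]) (defect_sq (iterC w u))%:E <= (nsq u)%:E.
Proof.
have EN N v : \esum_(w in [set: seq I])
    (if (size w < N)%N then defect_sq (iterC w v) else 0)%:E <= (nsq v)%:E.
  elim: N v => [|N IHN] v.
    by rewrite esum1 ?lee_fin ?nsq_ge0.
  rewrite esum_word /=; last first.
    by move=> w; case: ifP => _; rewrite lee_fin// defect_sq_ge0.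
  rewrite -(defect_split v); apply: leeD => //; apply: le_esum => i _.
  exact: IHN.
apply: esum_le_seq => s us; apply: le_trans (EN (\max_(w <- s) size w).+1 u).
apply: le_trans (esum_ge_seq _ us); rewrite big_seq [leRHS]big_seq.
apply: lee_sum => w ws; rewrite ifT// ltnS.
by rewrite leq_bigmax_seq.
Qed.

(** Unfolding [defect_split] N times leaves the squared norms over words of length N, and each
    letter contributes a factor r by [C_row]. *)
Lemma defect_esum_ge u N : (nsq u)%:E <=
  \esum_(w in [set: seq I]) (defect_sq (iterC w u))%:E + (r ^+ N * nsq u)%:E.
Proof.
case/andP: r01 => r0 _.
elim: N u => [|N IHN] u.
  rewrite expr0 mul1r leeDr// esum_ge0// => w _.
  by rewrite lee_fin defect_sq_ge0.
rewrite esum_word; last by move=> w; rewrite lee_fin defect_sq_ge0.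
rewrite -{1}(defect_split u) -addeA leeD2l//.
apply: (@le_trans _ _ (\esum_(i in [set: I])
    (\esum_(a in [set: seq I]) (defect_sq (iterC (i :: a) u))%:E
     + (r ^+ N * nsq (C i u))%:E))).
  by apply: le_esum => i _; exact: IHN.
rewrite esumD.
- rewrite leeD2l//; apply: esum_le_seq => s us; rewrite sumEFin lee_fin.
  by rewrite -mulr_sumr exprSr -mulrA ler_wpM2l ?exprn_ge0// C_row.
- by move=> i _; apply: esum_ge0 => w _; rewrite lee_fin defect_sq_ge0.
- by move=> i _; rewrite lee_fin mulr_ge0 ?exprn_ge0 ?nsq_ge0.
Qed.

(** Strictness of r < 1 enters here: otherwise e <= r^N |u|^2 for every N. This lower bound is the
    source of almost unitality. *)
Lemma defect_finite u (e : R) : (0 < e)%R -> exists2 s : seq (seq I), uniq s &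
  (nsq u - e <= \sum_(w <- s) defect_sq (iterC w u))%R.
Proof.
move=> e0; apply: contrapT => /forall2NP h.
have le : \esum_(w in [set: seq I]) (defect_sq (iterC w u))%:E <= (nsq u - e)%:E.
  apply: esum_le_seq => s us; rewrite sumEFin lee_fin.
  by have [//|/negP] := h s; rewrite -ltNge => /ltW.
have lt N : (e <= r ^+ N * nsq u)%R.
  have := le_trans (defect_esum_ge u N) (leeD2r _ le).
  by rewrite -EFinD lee_fin => ?; lra.
have cv : ((fun N => r ^+ N * nsq u)%R @ \oo --> (0 * nsq u)%R).
  apply: cvgMl; apply: cvg_expr; rewrite ger0_norm; by case/andP: r01.
have : (e <= 0 * nsq u)%R.
  rewrite -(cvg_lim _ cv)//; apply: limr_ge; first exact: cvgP cv.
  by near=> N; exact: lt.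
by rewrite mul0r leNgt e0.
Unshelve. all: by end_near.
Qed.

End DefectForm.

(** * Scalar Poisson kernels with values in N_J *)

Section PoissonKernel.
Context (R : realType) (n : option nat) (H : hilbertType R).
Context (P : set (free_algebra R n)) (T : gen n -> H -> H) (r : R).
Notation F := (fock R n).
Notation S := (@creation R n).
Notation N := (NJ P).
Notation B := (@compressed_creation R n P).
Notation C := (fun i => adj (T i)).
Hypothesis bT : forall i, bounded_ops H (T i).
Hypothesis TP : forall p, P p -> eval_op T p = 0.
Hypothesis r01 : 0 <= r < 1.
Hypothesis C_row : forall (s : seq (gen n)) x, uniq s ->
  \sum_(i <- s) nsq (adj (T i) x) <= r * nsq x.
Implicit Types (x : H) (w : word n) (f g : F).

Let C_linear i : linear (C i).
Proof. exact: adj_linear. Qed.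

Lemma adj_word w : adj (word_op T w) = iterC C w.
Proof.
elim: w => [|i w IHw]; first exact: adj_id.
by rewrite /= adj_comp ?IHw//; exact: bounded_word.
Qed.

Lemma defect_sum_le (s : seq (word n)) x : uniq s ->
  \sum_(w <- s) defect_sq C (iterC C w x) <= nsq x.
Proof.
move=> us; rewrite -lee_fin -sumEFin.
by apply: le_trans (defect_esum_le r01 C_row x); exact: esum_ge_seq.
Qed.

Section Functional.
Context (lam : H -> R[i]).
Hypothesis lam_linear : scalar lam.
Hypothesis lam_le : forall x, sqmod (lam x) <= defect_sq C x.

Lemma kernel_l2 x : (fun w => lam (iterC C w x)) \in @l2_pred R (word n).
Proof.
apply/l2P; exists (nsq x) => s us; apply: le_trans (defect_sum_le x us).
by apply: ler_sum => w _; exact: lam_le.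
Qed.

Definition kernel x : F := L2 (kernel_l2 x).

Lemma kernel_linear : linear kernel.
Proof.
move=> a x y; apply: l2_ext => w; rewrite l2_combE /= -lam_linear.
by rewrite (iterC_linear C_linear).
Qed.

(** Deleting the first letter i amounts to starting the iteration at C_i x; hence S_i^* L = L
    C_i. *)
Lemma tail_kernel i x : tail i (kernel x) = kernel (adj (T i) x).
Proof. exact: l2_ext. Qed.

Lemma inner_word_kernel w f x :
  inner (word_op S w f) (kernel x) = inner f (kernel (iterC C w x)).
Proof.
elim: w x => [|i w IHw] x //.
by rewrite -[word_op S _ f]/(S i (word_op S w f)) inner_creation tail_kernel IHw.
Qed.

(** Moving p(S) across gives <f, L (p(T)^* x)>, which vanishes with p(T). *)
Lemma inner_eval_kernel p f x : P p -> inner (eval_op S p f) (kernel x) = 0.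
Proof.
move=> Pp; rewrite /eval_op fct_sumE inner_suml.
transitivity (inner f (kernel (\sum_(w <- finsupp p) (p w)^*%C *: iterC C w x))).
  rewrite (op_linear_sum _ _ _ kernel_linear).
  rewrite inner_sumr; apply: eq_bigr => w _.
  rewrite -[LHS]/(inner (p w *: word_op S w f) (kernel x)) innerZl innerZr conjcK.
  by rewrite inner_word_kernel.
have -> : \sum_(w <- finsupp p) (p w)^*%C *: iterC C w x = 0.
  apply: inner_extr => y; rewrite inner0r inner_sumr.
  have : inner (eval_op T p y) x = 0 by rewrite TP ?inner0l.
  rewrite /eval_op fct_sumE inner_suml => h; apply: etrans h.
  apply: eq_bigr => w _; rewrite innerZr conjcK.
  rewrite -[RHS]/(inner (p w *: word_op T w y) x) innerZl -adj_word.
  by rewrite adjP//; exact: bounded_word.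
by rewrite (op_linear0 kernel_linear) inner0r.
Qed.

(** Bounded operators preserving the complement of the kernel vectors form a WOT closed unital
    algebra; it contains S_i because S_i^* sends kernel vectors to kernel vectors. *)
Lemma Finfty_kernel X : Finfty X -> forall g, (forall x, inner g (kernel x) = 0) ->
  forall x, inner (X g) (kernel x) = 0.
Proof.
pose A := [set X : F -> F | bounded_ops F X /\ forall g,
  (forall x, inner g (kernel x) = 0) -> forall x, inner (X g) (kernel x) = 0].
suff AF : @Finfty R n `<=` A by move=> /AF[].
apply: smallest_sub; last first.
  move=> _ [i _ <-]; split; first exact: bounded_creation.
  by move=> g g0 x; rewrite inner_creation tail_kernel.
split.
  split; first split.
  - by move=> Y [].
  - by split=> [|g g0 x]; [exact: bounded_0|rewrite inner0l].
  - move=> a Y Z [bY Y0] [bZ Z0]; split; first exact: bounded_comb.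
    move=> g g0 x; rewrite -[LHS]/(inner (a *: Y g + Z g) (kernel x)).
    by rewrite innerDl innerZl Y0// Z0// mulr0 addr0.
  - by split=> //; exact: bounded_id.
  - move=> Y Z [bY Y0] [bZ Z0]; split; first exact: bounded_comp.
    by move=> g g0 x /=; apply: Y0 => y; exact: Z0.
move=> Y bY HY; split=> // g g0 x; apply: lec_eps_eq0 => e e0.
have [Z [_ Z0] /(_ (g, kernel x))] := HY e [:: (g, kernel x)] e0.
by rewrite inE eqxx => /(_ isT) /=; rewrite innerBl Z0// subr0.
Qed.

(** Elements of [Finfty] with range orthogonal to all kernel vectors form a WOT closed two-sided
    ideal containing the p(S), hence J. Stability under left multiplication is [Finfty_kernel]. *)
Lemma kernel_NJ x : kernel x \in perp_pred (ideal_range P).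
Proof.
pose A := [set X : F -> F | Finfty X /\ forall g y, inner (X g) (kernel y) = 0].
suff AJ : ideal_of P `<=` A.
  apply/perpP => _ [X [f [/AJ[_ X0] ->]]].
  by rewrite inner_conj X0 rmorph0.
have uF := @Finfty_unital R n.
apply: smallest_sub; last first.
  move=> _ [p Pp <-]; split; last by move=> g y; exact: inner_eval_kernel.
  by apply: (unital_eval p uF) => i; exact: Finfty_creation.
split.
  split.
  - by move=> Y [].
  - split.
    + by move=> Y [FY _]; exact: (unital_sub uF FY).
    + by split; [case: uF => -[]|move=> g y; rewrite inner0l].
    + move=> a Y Z [FY Y0] [FZ Z0]; split; first exact: (unital_comb _ uF).
      move=> g y; rewrite -[LHS]/(inner (a *: Y g + Z g) (kernel y)).
      by rewrite innerDl innerZl Y0 Z0 mulr0 addr0.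
  - move=> X Y FX [FY Y0]; split; split; try exact: (unital_comp uF).
      by move=> g y /=; apply: Finfty_kernel => // z; exact: Y0.
    by move=> g y /=; exact: Y0.
move=> X bX HX; split.
  apply: Finfty_closed => // e s e0; have [Y [FY _] HY] := HX e s e0.
  by exists Y.
move=> g y; apply: lec_eps_eq0 => e e0.
have [Z [_ Z0] /(_ (g, kernel y))] := HX e [:: (g, kernel y)] e0.
by rewrite inE eqxx => /(_ isT) /=; rewrite innerBl Z0 subr0.
Qed.

Definition kernelN x : N := Perp (kernel_NJ x).

Lemma kernelN_linear : linear kernelN.
Proof. by move=> a x y; apply: val_inj; rewrite linearP; exact: kernel_linear. Qed.

Lemma adj_B_kernel i x : adj (B i) (kernelN x) = kernelN (adj (T i) x).
Proof.
rewrite adj_B; apply: inner_extl => y.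
apply: (etrans (proj_inner (tail i (val (kernelN x))) y)).
by rewrite -[val (kernelN x)]/(kernel x) tail_kernel.
Qed.

Lemma nsq_kernelN x :
  (nsq (kernelN x))%:E = (\esum_(w in [set: word n]) (sqmod (lam (iterC C w x)))%:E)%E.
Proof. by rewrite -[nsq (kernelN x)]/(nsq (kernel x)) -l2_nsq. Qed.

End Functional.

(** A finite set [W] of words nearly exhausts the norm of every x in s; functionals exact on the
    finitely many vectors C_w x then lose nothing more. *)
Lemma kernel_approx (s : seq H) (e : R) : 0 < e ->
  exists m (L : nat -> H -> N),
    [/\ forall k, linear (L k),
        forall x, \sum_(k < m) nsq (L k x) <= nsq x,
        forall k i x, adj (B i) (L k x) = L k (adj (T i) x)
      & forall x, x \in s -> nsq x - e <= \sum_(k < m) nsq (L k x)].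
Proof.
move=> e0.
have [W uW HW] : exists2 W : seq (word n), uniq W & forall x, x \in s ->
    nsq x - e <= \sum_(w <- W) defect_sq C (iterC C w x).
  elim: s => [|x s [W uW HW]]; first by exists [::].
  have [V uV HV] := defect_finite r01 C_row x e0.
  have sub (X Y : seq (word n)) y : uniq X -> {subset X <= Y} -> uniq Y ->
      \sum_(w <- X) defect_sq C (iterC C w y) <= \sum_(w <- Y) defect_sq C (iterC C w y).
    move=> uX XY uY; have pXY : perm_eq X [seq w <- Y | w \in X].
      apply: uniq_perm => //; first exact: filter_uniq.
      by move=> w; rewrite mem_filter; case wX: (w \in X) => //=; rewrite XY.
    rewrite (perm_big _ pXY) big_filter [leRHS](bigID (fun w => w \in X)) /= lerDl.
    by apply: sumr_ge0 => w _; exact: (defect_sq_ge0 r01 C_row).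
  exists (undup (V ++ W)); first exact: undup_uniq.
  move=> y; rewrite inE => /predU1P[->|/HW] => [|yW].
    apply: le_trans HV _; apply: sub; rewrite ?undup_uniq//.
    by move=> w wV; rewrite mem_undup mem_cat wV.
  apply: le_trans yW _; apply: sub; rewrite ?undup_uniq//.
  by move=> w wW; rewrite mem_undup mem_cat wW orbT.
have [m [lam [linl le ge]]] := form_finite_rank
  [seq iterC C w x | w <- W, x <- s]
  (defect_linear C_linear r01 C_row) (defect_conj r01 C_row) (defect_ge0 r01 C_row).
have {}le v : \sum_(k < m) sqmod (lam k v) <= defect_sq C v.
  by have := le v; rewrite (defectE r01 C_row).
(* Extension by zero past m, since every natural index must carry a linear, dominated functional. *)
pose lam' k := if (k < m)%N then lam k else fun=> 0.
have linl' k : scalar (lam' k).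
  by rewrite /lam'; case: ifP => // _ a x y; rewrite mulr0 addr0.
have lam'_le k x : sqmod (lam' k x) <= defect_sq C x.
  rewrite /lam'; case: ifP => [km|_].
    apply: le_trans (le x); rewrite (bigD1 (Ordinal km))//= lerDl.
    by apply: sumr_ge0 => j _; exact: sqmod_ge0.
  by rewrite /sqmod /= expr0n addr0; exact: (defect_sq_ge0 r01 C_row).
have sumE x : (\sum_(k < m) (nsq (kernelN (linl' k) (lam'_le k) x))%:E)%E =
    (\esum_(w in [set: word n]) (\sum_(k < m) sqmod (lam k (iterC C w x)))%:E)%E.
  under eq_bigr do rewrite nsq_kernelN.
  rewrite -esum_sum; last by move=> *; rewrite lee_fin sqmod_ge0.
  apply: eq_esum => w _; rewrite -sumEFin; apply: eq_bigr => k _.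
  by rewrite /lam' ltn_ord.
exists m, (fun k => kernelN (linl' k) (lam'_le k)); split.
- by move=> k; exact: kernelN_linear.
- move=> x; rewrite -lee_fin -sumEFin sumE.
  apply: le_trans (defect_esum_le r01 C_row x); apply: le_esum => w _.
  by rewrite lee_fin le.
- by move=> k i x; exact: adj_B_kernel.
- move=> x xs; rewrite -lee_fin -sumEFin sumE.
  apply: le_trans (esum_ge_seq _ uW); rewrite sumEFin lee_fin.
  apply: le_trans (HW x xs) _; rewrite big_seq [leRHS]big_seq.
  apply: ler_sum => w wW; rewrite -[leLHS]/(complex.Re (defect_sq C (iterC C w x))%:C).
  rewrite -(defectE r01 C_row); apply: ge.
  by apply/allpairsP; exists (w, x).
Qed.

End PoissonKernel.

(** * Ultralimits of completely positive forms *)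

Section Ultralimit.
Context (R : realType) (T : Type) (U : set_system T).
Context {UU : UltraFilter U}.
Implicit Types (f g : T -> R[i]) (l k : R[i]).

Definition ulim f l := forall e : R, 0 < e -> U [set p | sqmod (f p - l) <= e].

(** Compactness of [-M, M] yields a cluster point; an ultrafilter contains each set or its
    complement, and the complement would contradict clustering. *)
Lemma ulim_real_exists (f : T -> R) (M : R) : (forall p, `|f p| <= M) ->
  exists l : R, forall e : R, 0 < e -> U [set p | (f p - l) ^+ 2 <= e].
Proof.
move=> fM.
have UF : (f @ U) `[- M, M]%classic.
  change (U [set p | `[- M, M]%classic (f p)]); apply: filterS filterT => p _.
  have := fM p; rewrite ler_norml => fMp.
  by rewrite /= in_itv /= fMp.
have [l [_ lU]] := segment_compact _ UF.
exists l => e e0; have [//|Un] := in_ultra_setVsetC [set p | (f p - l) ^+ 2 <= e] UU.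
have s0 : 0 < Num.sqrt e by rewrite sqrtr_gt0.
have Uim : (f @ U) (f @` (~` [set p | (f p - l) ^+ 2 <= e])).
  change (U [set p | (f @` (~` [set p | (f p - l) ^+ 2 <= e])) (f p)]).
  by apply: filterS Un => p np /=; exists p.
have [_ [[p np <-]]] := lU _ _ Uim (nbhsx_ballx l _ s0).
rewrite -ball_normE /= => lp; case: np => /=.
rewrite -(sqr_sqrtr (ltW e0)) -real_normK ?num_real//.
by rewrite ler_pXn2r ?nnegrE ?sqrtr_ge0// distrC ltW.
Qed.

Lemma ulim_exists f (M : R) : (forall p, sqmod (f p) <= M) -> exists l, ulim f l.
Proof.
move=> fM.
have bnd (t : R) : t ^+ 2 <= M -> `|t| <= M + 1.
  by move=> tM; rewrite ler_norml; apply/andP; split; nra.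
have [a Ha] : exists l : R, forall e : R, 0 < e ->
    U [set p | (complex.Re (f p) - l) ^+ 2 <= e].
  apply: (@ulim_real_exists _ (M + 1)) => p; apply: bnd.
  by apply: le_trans (fM p); rewrite lerDl sqr_ge0.
have [b Hb] : exists l : R, forall e : R, 0 < e ->
    U [set p | (complex.Im (f p) - l) ^+ 2 <= e].
  apply: (@ulim_real_exists _ (M + 1)) => p; apply: bnd.
  by apply: le_trans (fM p); rewrite lerDr sqr_ge0.
exists (a +i* b) => e e0; have e2 : 0 < e / 2 by rewrite divr_gt0.
apply: filterS (filterI (Ha _ e2) (Hb _ e2)) => p [] /=.
by rewrite /sqmod; case: (f p) => c d /= h1 h2; lra.
Qed.

Lemma sqmod_eq0 (z : R[i]) : sqmod z <= 0 -> z = 0.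
Proof.
case: z => a b; rewrite /sqmod /= => h.
have := sqr_ge0 a; have := sqr_ge0 b => b0 a0.
have /eqP : a ^+ 2 = 0 by lra.
have /eqP : b ^+ 2 = 0 by lra.
by rewrite !sqrf_eq0 => /eqP-> /eqP->.
Qed.

Lemma sqmodN (z : R[i]) : sqmod (- z) = sqmod z.
Proof. by case: z => a b; rewrite /sqmod /= !sqrrN. Qed.

Lemma ulim_unique f l k : ulim f l -> ulim f k -> l = k.
Proof.
move=> fl fk; apply/eqP; rewrite -subr_eq0; apply/eqP/sqmod_eq0.
apply/ler_addgt0Pl => e e0; rewrite addr0.
have e4 : 0 < e / 4 by rewrite divr_gt0.
have [p [/= pl pk]] := filter_ex (filterI (fl _ e4) (fk _ e4)).
have := sqmodD (- (f p - l)) (f p - k); rewrite sqmodN.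
by rewrite (_ : - (f p - l) + (f p - k) = l - k); [lra|ring].
Qed.

Lemma ulim_comb a f g l k : ulim f l -> ulim g k ->
  ulim (fun p => a * f p + g p) (a * l + k).
Proof.
move=> fl gk e e0; have a0 := sqmod_ge0 a.
have a1 : 0 < sqmod a + 1 by rewrite ltr_wpDl.
have e2 : 0 < e / 4 by rewrite divr_gt0.
have e1 : 0 < e / 4 / (sqmod a + 1) by rewrite divr_gt0.
apply: filterS (filterI (fl _ e1) (gk _ e2)) => p [/= pl pk].
rewrite (_ : _ - _ = a * (f p - l) + (g p - k)); last by ring.
apply: le_trans (sqmodD _ _) _; rewrite sqmodM.
have : sqmod a * sqmod (f p - l) <= e / 4.
  apply: le_trans (ler_wpM2l a0 pl) _.
  by rewrite mulrA ler_pdivrMr//; lra.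
lra.
Qed.

Lemma ulim_cst l : ulim (fun=> l) l.
Proof.
move=> e e0; apply: filterS filterT => p _ /=.
by rewrite subrr /sqmod /= expr0n addr0 ltW.
Qed.

Lemma ulim_sum (I : Type) (s : seq I) (f : I -> T -> R[i]) (l : I -> R[i]) :
  (forall i, ulim (f i) (l i)) ->
  ulim (fun p => \sum_(i <- s) f i p) (\sum_(i <- s) l i).
Proof.
move=> fl; elim: s => [|i s IHs].
  by under eq_fun do rewrite big_nil; rewrite big_nil; exact: ulim_cst.
under eq_fun do rewrite big_cons; rewrite big_cons.
by have := ulim_comb 1 (fl i) IHs; under eq_fun do rewrite mul1r; rewrite mul1r.
Qed.

Lemma ulim_ge0 f l : ulim f l -> (forall p, 0 <= f p) -> 0 <= l.
Proof.
move=> fl f0; have h e : 0 < e -> exists2 t : R, 0 <= t &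
    (t - complex.Re l) ^+ 2 + complex.Im l ^+ 2 <= e.
  move=> e0; have [p /= pl] := filter_ex (fl e e0).
  have [Re0 Im0] := lec0_ReIm (f0 p); exists (complex.Re (f p)) => //.
  move: pl Im0; rewrite /sqmod; case: (f p) l {fl} => [a b] [c d] /= + b0.
  by rewrite b0 sub0r sqrrN.
rewrite lecE /=; apply/andP; split.
  rewrite -sqrf_eq0 eq_le sqr_ge0 andbT; apply/ler_addgt0Pl => e /h[t _].
  by rewrite addr0; apply: le_trans; rewrite lerDr sqr_ge0.
rewrite leNgt; apply/negP => l0.
have l2 : 0 < complex.Re l ^+ 2 / 2 by rewrite divr_gt0// exprn_even_gt0//= lt_eqF.
have [t t0] := h _ l2; have := sqr_ge0 (complex.Im l).
move: (complex.Re l) (complex.Im l ^+ 2) l0 l2 => a b a0 l2 b0.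
by apply/negP; rewrite -ltNge; nra.
Qed.

(** The factor 2 is the price of [sqmodD]; what later steps need is some bound on the limit. *)
Lemma ulim_bound f l (c : R) : ulim f l -> (forall p, sqmod (f p) <= c) ->
  sqmod l <= 2 * c.
Proof.
move=> fl fc; apply/ler_addgt0Pr => e e0.
have e2 : 0 < e / 2 by rewrite divr_gt0.
have [p /= pl] := filter_ex (fl _ e2); have := fc p.
have := sqmodD (- (f p - l)) (f p); rewrite sqmodN.
by rewrite (_ : - (f p - l) + f p = l); [lra|ring].
Qed.

End Ultralimit.

(** * Finite families of kernels and their completely positive forms *)

Section KernelFamilies.
Context (R : realType) (K H : hilbertType R).

(** Kraus-type data with sum_k L_k^* L_k <= 1. [kf_form] is the form of sum_k L_k^* X L_k, so no
    adjoint between two different spaces is built. *)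
Record kernel_family := KernelFamily {
  kf_size : nat;
  kf_map : nat -> H -> K;
  kf_linear : forall k, linear (kf_map k);
  kf_le : forall x, \sum_(k < kf_size) nsq (kf_map k x) <= nsq x }.

Definition kf_form (p : kernel_family) (X : K -> K) (x y : H) : R[i] :=
  \sum_(k < kf_size p) inner (X (kf_map p k x)) (kf_map p k y).

Lemma sum_CS m (a b : 'I_m -> K) :
  (\sum_k rinner (a k) (b k)) ^+ 2 <= (\sum_k nsq (a k)) * (\sum_k nsq (b k)).
Proof.
set Z := \sum_k rinner _ _; set A := \sum_k nsq (a k); set B := \sum_k nsq (b k).
have B0 : 0 <= B by apply: sumr_ge0 => k _; exact: nsq_ge0.
have [b0|BN0] := eqVneq B 0.
  have bk k : b k = 0.
    apply: nsq_eq0; move/eqP: b0; rewrite psumr_eq0 => [/allP/(_ k)|i _];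
      last exact: nsq_ge0.
    by rewrite mem_index_enum => /(_ isT)/eqP.
  rewrite b0 mulr0 /Z big1 ?expr0n// => k _.
  by rewrite bk /rinner inner0r.
have {}B0 : 0 < B by rewrite lt_def BN0.
have : 0 <= \sum_k nsq (B%:C *: a k - Z%:C *: b k).
  by apply: sumr_ge0 => k _; exact: nsq_ge0.
have -> : \sum_k nsq (B%:C *: a k - Z%:C *: b k) = B * (A * B - Z ^+ 2).
  transitivity (\sum_k (B ^+ 2 * nsq (a k) + - (2 * B * Z) * rinner (a k) (b k)
                        + Z ^+ 2 * nsq (b k))).
    apply: eq_bigr => k _.
    by rewrite nsqB !nsqZ rinnerZl rinnerZr /sqmod /= !expr0n /=; ring.
  by rewrite !big_split /= -!mulr_sumr -/A -/B -/Z; ring.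
by rewrite pmulr_rge0// subr_ge0.
Qed.

(** Real and imaginary parts are bounded separately by Cauchy-Schwarz in the direct sum, whence the
    factor 2. *)
Lemma kf_form_bound p X (M : R) x y : 0 <= M -> (forall z, nsq (X z) <= M * nsq z) ->
  sqmod (kf_form p X x y) <= 2 * (M * nsq x * nsq y).
Proof.
move=> M0 XM.
have le z : (\sum_(k < kf_size p) rinner (X (kf_map p k x)) (kf_map p k z)) ^+ 2
    <= M * nsq x * nsq z.
  apply: le_trans (sum_CS _ _) _; apply: ler_pM.
  - by apply: sumr_ge0 => k _; exact: nsq_ge0.
  - by apply: sumr_ge0 => k _; exact: nsq_ge0.
  - apply: le_trans (_ : \sum_(k < kf_size p) M * nsq (kf_map p k x) <= _).
      by apply: ler_sum => k _; exact: XM.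
    by rewrite -mulr_sumr ler_wpM2l// kf_le.
  - exact: kf_le.
have Im : complex.Im (kf_form p X x y) =
    \sum_(k < kf_size p) rinner (X (kf_map p k x)) (kf_map p k ('i *: y)).
  rewrite /kf_form raddf_sum; apply: eq_bigr => k _.
  by rewrite (op_linearZ _ _ (@kf_linear p k)) innerE.
have := le y; have := le ('i *: y); rewrite nsqZ /sqmod Im.
have -> : complex.Re (kf_form p X x y) =
    \sum_(k < kf_size p) rinner (X (kf_map p k x)) (kf_map p k y).
  by rewrite /kf_form raddf_sum.
by rewrite /= expr0n expr1n add0r mul1r; lra.
Qed.

Lemma kf_form_comb p a X Y x y :
  kf_form p (a *: X + Y) x y = a * kf_form p X x y + kf_form p Y x y.
Proof.
rewrite /kf_form mulr_sumr -big_split /=; apply: eq_bigr => k _.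
by rewrite -innerZl -innerDl.
Qed.

Lemma kf_form_linearl p X a x x' y : linear X ->
  kf_form p X (a *: x + x') y = a * kf_form p X x y + kf_form p X x' y.
Proof.
move=> lX; rewrite /kf_form mulr_sumr -big_split /=; apply: eq_bigr => k _.
by rewrite kf_linear lX innerDl innerZl.
Qed.

Lemma kf_form_linearr p X a x y y' :
  kf_form p X x (a *: y + y') = a^*%C * kf_form p X x y + kf_form p X x y'.
Proof.
rewrite /kf_form mulr_sumr -big_split /=; apply: eq_bigr => k _.
by rewrite kf_linear innerDr innerZr.
Qed.

Lemma kf_form_pos p m (X : 'I_m -> 'I_m -> K -> K) (x : 'I_m -> H) :
  positive_opmx X -> 0 <= \sum_i \sum_j kf_form p (X i j) (x j) (x i).
Proof.
move=> X0; rewrite /kf_form.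
under eq_bigr do rewrite exchange_big; rewrite exchange_big /=.
by apply: sumr_ge0 => k _; exact: (X0 (fun i => kf_map p k (x i))).
Qed.

Lemma kf_form_id p x : kf_form p idfun x x = (\sum_(k < kf_size p) nsq (kf_map p k x))%:C.
Proof. by rewrite rmorph_sum; apply: eq_bigr => k _; exact: nsqE. Qed.

End KernelFamilies.

(** Complex polarization at x + y and i x + y. It is needed because almost unitality controls
    diagonal values only. *)
Lemma quadratic_eq0 (R : realType) (H : hilbertType R) (X : H -> H) :
  linear X -> (forall x, inner (X x) x = 0) -> forall x, X x = 0.
Proof.
move=> lX h x; apply: inner_extl => y; rewrite inner0l.
have := h (x + y); have := h ('i *: x + y).
rewrite lX (op_linearD _ _ lX) !innerDl !innerDr !innerZl !innerZr !h.
move: (inner (X x) y) (inner (X y) x) => [a b] [c d].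
move=> /eqP; rewrite eq_complex /= => /andP[/eqP h1 /eqP h2].
move=> /eqP; rewrite eq_complex /= => /andP[/eqP h3 /eqP h4].
by apply/eqP; rewrite eq_complex /=; apply/andP; split; apply/eqP; lra.
Qed.

(** * The limit map on all bounded operators *)

Section LimitMap.
Context (R : realType) (K H : hilbertType R).
Context (U : set_system (kernel_family K H)).
Context {UU : UltraFilter U}.
Implicit Types (X Y : K -> K) (x y z : H).

Definition lim_op X x : H :=
  get [set z | forall y, ulim U (fun p => kf_form p X x y) (inner z y)].

(** The limits exist pointwise by boundedness; their conjugates form a bounded linear functional of
    y, which Riesz represents. *)
Lemma lim_opP X x y : bounded_ops K X ->
  ulim U (fun p => kf_form p X x y) (inner (lim_op X x) y).
Proof.
move=> /bounded_opsP[lX [M M0 XM]].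
pose Q z := forall y, ulim U (fun p => kf_form p X x y) (inner z y).
suff ex : exists z, Q z by exact: (@getPex _ Q ex).
have exl u : exists l, ulim U (fun p => kf_form p X x u) l.
  apply: (@ulim_exists _ _ _ _ _ (2 * (M * nsq x * nsq u))) => p.
  exact: kf_form_bound.
have [phi Hphi] := choice exl.
have [|u|z Hz] := @riesz _ _ (fun y => (phi y)^*%C) (2 * (2 * (M * nsq x))).
- move=> a u v; rewrite -[in RHS](conjcK a) -rmorphM -rmorphD /=; congr _^*%C.
  apply: (ulim_unique (Hphi _)).
  under eq_fun do rewrite kf_form_linearr.
  exact: ulim_comb.
- rewrite (_ : sqmod _ = sqmod (phi u)).
    rewrite (_ : _ * nsq u = 2 * (2 * (M * nsq x * nsq u))); last by ring.
    by apply: (ulim_bound (Hphi u)) => p; exact: kf_form_bound.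
  by case: (phi u) => a b; rewrite /sqmod /= sqrrN.
exists z => v; rewrite inner_conj -Hz conjcK; exact: Hphi.
Qed.

Lemma lim_op_eq X x z : bounded_ops K X ->
  (forall y, ulim U (fun p => kf_form p X x y) (inner z y)) -> lim_op X x = z.
Proof.
move=> bX h; apply: inner_extl => y; exact: ulim_unique (lim_opP _ _ bX) (h y).
Qed.

Lemma lim_op_bounded X : bounded_ops K X -> bounded_ops H (lim_op X).
Proof.
move=> bX; have /bounded_opsP[lX [M M0 XM]] := bX; apply/bounded_opsP; split.
  move=> a x y; apply: lim_op_eq => // z; rewrite innerDl innerZl.
  under eq_fun do rewrite kf_form_linearl//.
  by apply: ulim_comb; exact: lim_opP.
exists (4 * M); first by rewrite mulr_ge0.
move=> x; set z := lim_op X x.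
have := ulim_bound (lim_opP x z bX) (fun p => kf_form_bound p x z M0 XM).
rewrite -/z nsqE /sqmod /= expr0n addr0 expr2 => h.
have [->|z0] := eqVneq (nsq z) 0; first by rewrite !mulr_ge0 ?nsq_ge0.
have {}z0 : 0 < nsq z by rewrite lt_def z0 nsq_ge0.
rewrite -(ler_pM2r z0); have := h UU; lra.
Qed.

Lemma lim_op_comb a X Y : bounded_ops K X -> bounded_ops K Y ->
  lim_op (a *: X + Y) = a *: lim_op X + lim_op Y.
Proof.
move=> bX bY; apply/funext => x; apply: lim_op_eq; first exact: bounded_comb.
move=> y; rewrite -[X in inner X y]/(a *: lim_op X x + lim_op Y x) innerDl innerZl.
under eq_fun do rewrite kf_form_comb.
by apply: ulim_comb; exact: lim_opP.
Qed.

Lemma lim_op_pos m (X : 'I_m -> 'I_m -> K -> K) :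
  (forall i j, bounded_ops K (X i j)) -> positive_opmx X ->
  positive_opmx (fun i j => lim_op (X i j)).
Proof.
move=> bX X0 x.
apply: (@ulim_ge0 _ _ U _
  (fun p => \sum_i \sum_j kf_form p (X i j) (x j) (x i))).
  apply: ulim_sum => i; apply: ulim_sum => j; exact: lim_opP.
by move=> p; exact: kf_form_pos.
Qed.

Hypothesis U_unital : forall x (e : R), 0 < e ->
  U [set p | nsq x - e <= \sum_(k < kf_size p) nsq (kf_map p k x)].

Lemma lim_op_id : lim_op idfun = idfun.
Proof.
have bi := lim_op_bounded (bounded_id K).
have lW : linear (fun x => lim_op idfun x - x).
  by move=> a x y; rewrite bi.1 scalerBr opprD addrACA.
apply/funext => x; apply/eqP; rewrite -subr_eq0; apply/eqP.
move: x; apply: quadratic_eq0 lW _ => x; rewrite innerBl; apply/eqP; rewrite subr_eq0.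
apply/eqP/(ulim_unique (lim_opP x x (bounded_id K))) => e e0.
(* [ulim] measures squared distance, so the gap itself must stay within sqrt e. *)
have s0 : 0 < Num.sqrt e by rewrite sqrtr_gt0.
apply: filterS (U_unital x s0) => p /= h.
rewrite kf_form_id nsqE -rmorphB /sqmod /= expr0n addr0.
have := kf_le p x; move: (\sum_(k < _) _) h => t h1 h2.
rewrite -[leRHS](sqr_sqrtr (ltW e0)) -sqrrN ler_pXn2r ?nnegrE ?sqrtr_ge0//; lra.
Qed.

End LimitMap.

Section IntertwiningLimit.
Context (R : realType) (n : option nat) (K H : hilbertType R).
Context (U : set_system (kernel_family K H)).
Context {UU : UltraFilter U}.
Context (B : gen n -> K -> K) (T : gen n -> H -> H).
Hypothesis bB : forall i, bounded_ops K (B i).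
Hypothesis bT : forall i, bounded_ops H (T i).

(** The factor r may vary with the family; bounding only 1 - r makes these sets decrease with e. *)
Definition almost_intertwines (e : R) (p : kernel_family K H) :=
  exists r : R, [/\ 0 <= r <= 1, 1 - r <= e
    & forall k i x, adj (B i) (kf_map p k x) = r%:C *: kf_map p k (adj (T i) x)].

Hypothesis U_unital : forall x (e : R), 0 < e ->
  U [set p | nsq x - e <= \sum_(k < kf_size p) nsq (kf_map p k x)].
Hypothesis U_intertwines : forall e : R, 0 < e -> U (almost_intertwines e).

Lemma onem_expr_le (r : R) N : 0 <= r <= 1 -> 1 - r ^+ N <= N%:R * (1 - r).
Proof.
move=> /andP[r0 r1]; elim: N => [|N IHN]; first by rewrite expr0 subrr mul0r.
rewrite exprSr -natr1 mulrDl mul1r.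
have h : r ^+ N <= 1 by rewrite exprn_ile1.
have h0 : 0 <= r ^+ N by rewrite exprn_ge0.
rewrite (_ : 1 - r ^+ N * r = (1 - r ^+ N) + r ^+ N * (1 - r)); last by ring.
by apply: lerD => //; rewrite ler_piMl// subr_ge0.
Qed.

(** Moving the words onto the kernels turns the form of B_a B_b^* at x, y into r^(|a|+|b|) times the
    form of the identity at T_b^* x, T_a^* y, whose limit is known from [lim_op_id]. *)
Lemma lim_op_word (a b : word n) :
  lim_op U (word_op B a \o adj (word_op B b)) = word_op T a \o adj (word_op T b).
Proof.
have bBw w : bounded_ops K (word_op B w) by exact: bounded_word.
have bTw w : bounded_ops H (word_op T w) by exact: bounded_word.
apply/funext => x; apply: lim_op_eq => [|y e e0] /=.
  by apply: bounded_comp => //; exact: bounded_adj.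
rewrite (adjP (bTw a)).
set u := adj (word_op T b) x; set v := adj (word_op T a) y.
set z := inner u v; pose c := 2 * (1 * nsq u * nsq v); pose N := (size b + size a)%N.
have c0 : 0 <= c by rewrite !mulr_ge0 ?nsq_ge0.
have bound (p : kernel_family K H) : sqmod (kf_form p idfun u v) <= c.
  by apply: kf_form_bound => // w; rewrite mul1r.
have lim_uv : ulim U (fun p => kf_form p idfun u v) z.
  have := @lim_opP _ _ _ U UU _ u v (bounded_id K).
  by rewrite (lim_op_id U_unital).
have Nc0 : 0 < N%:R * c + 1 by rewrite ltr_wpDl// mulr_ge0.
(* The error splits as (w - z) + (r^N - 1) w, and [sqmodD] doubles each square, so each gets e/4.
   The second is at most N c (1 - r); adding 1 to N c avoids dividing by zero. *)
have d0 : 0 < e / 4 / (N%:R * c + 1) by rewrite !divr_gt0.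
have e4 : 0 < e / 4 by rewrite divr_gt0.
apply: filterS (filterI (lim_uv _ e4) (U_intertwines d0)) => p [/= pz [r [r01 re rT]]].
have wordL w k s : adj (word_op B w) (kf_map p k s) =
    (r ^+ size w)%:C *: kf_map p k (adj (word_op T w) s).
  elim: w s => [|i w IHw] s; first by rewrite /= !adj_id expr0 scale1r.
  rewrite -[word_op B _]/(B i \o word_op B w) -[word_op T _]/(T i \o word_op T w).
  rewrite (adj_comp (bB i) (bBw w)) (adj_comp (bT i) (bTw w)) /= rT.
  rewrite (op_linearZ _ _ (adj_linear (bBw w))) IHw scalerA.
  by rewrite -rmorphM -exprS.
have -> : kf_form p (word_op B a \o adj (word_op B b)) x y =
    (r ^+ N)%:C * kf_form p idfun u v.
  rewrite /kf_form mulr_sumr; apply: eq_bigr => k _ /=.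
  rewrite (adjP (bBw a)) !wordL innerZl innerZr conjcR mulrA -rmorphM.
  by rewrite -exprD.
move: (bound p) pz; set w := kf_form _ _ _ _ => wc wz.
rewrite (_ : _ - z = (w - z) + ((r ^+ N - 1)%:C) * w); last first.
  by rewrite rmorphB rmorph1; ring.
apply: le_trans (sqmodD _ _) _; rewrite sqmodM.
have -> : sqmod (r ^+ N - 1)%:C = (1 - r ^+ N) ^+ 2.
  by rewrite /sqmod /= expr0n addr0 -sqrrN opprB.
have /andP[r0 r1] := r01.
have h1 := onem_expr_le N r01.
have h2 : r ^+ N <= 1 by rewrite exprn_ile1.
have h3 : 0 <= r ^+ N by rewrite exprn_ge0.
have h4 : (1 - r ^+ N) ^+ 2 <= N%:R * (1 - r).
  by apply: le_trans h1; rewrite expr2 ler_piMl//; lra.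
have h5 : (1 - r ^+ N) ^+ 2 * sqmod w <= N%:R * (1 - r) * c.
  by rewrite ler_pM ?sqmod_ge0 ?sqr_ge0.
have h6 : N%:R * (1 - r) * c <= e / 4.
  apply: le_trans (_ : N%:R * c * (e / 4 / (N%:R * c + 1)) <= _).
    by rewrite mulrAC ler_wpM2l// mulr_ge0.
  by rewrite mulrA ler_pdivrMr// mulrC ler_wpM2l ?lerDl// ltW.
lra.
Qed.

End IntertwiningLimit.

Lemma adjZ (R : realType) (H : hilbertType R) (r : R) (X : H -> H) :
  bounded_ops H X -> adj (r%:C *: X) = r%:C *: adj X.
Proof.
move=> bX; apply: adj_eq.
  by rewrite -[_ *: _]addr0; apply: bounded_comb => //; exact: bounded_0.
move=> x y; rewrite -[LHS]/(inner (r%:C *: X x) y) -[RHS]/(inner x (r%:C *: adj X y)).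
by rewrite innerZl innerZr conjcR adjP.
Qed.

Lemma word_opZ (R : realType) n (H : hilbertType R) (r : R) (T : gen n -> H -> H) w :
  (forall i, linear (T i)) ->
  word_op (fun i => r%:C *: T i) w = (r ^+ size w)%:C *: word_op T w.
Proof.
move=> lT; elim: w => [|i w IHw]; first by rewrite /= expr0 scale1r.
apply/funext => x; rewrite -[LHS]/(r%:C *: T i (word_op _ w x)) IHw.
rewrite -[(_ *: word_op T w) x]/((r ^+ size w)%:C *: word_op T w x).
by rewrite (op_linearZ _ _ (lT i)) scalerA -rmorphM -exprS.
Qed.

(** * Existence of the Poisson transform of a constrained row *)

Section PoissonTransformExists.
Context (R : realType) (n : option nat) (H : hilbertType R).
Context (P : set (free_algebra R n)) (T : gen n -> H -> H).
Notation N := (NJ P).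
Notation B := (@compressed_creation R n P).
Hypothesis P_homogeneous : forall p, P p -> homogeneous p.
Hypothesis T_row : row_contraction T.
Hypothesis TP : forall p, P p -> eval_op T p = 0.

Let bT i : bounded_ops H (T i).
Proof. by case: T_row. Qed.

Lemma adj_row (s : seq (gen n)) x : uniq s ->
  \sum_(i <- s) nsq (adj (T i) x) <= nsq x.
Proof.
move=> us; rewrite -lee_fin -sumEFin; case: T_row => _ /(_ x).
apply: le_trans; apply: le_trans (esum_ge_seq _ us).
by apply: lee_sum => i _; rewrite adjP.
Qed.

(** Homogeneity enters here: all words of p share one length k, so p(rT) = r^k p(T). *)
Lemma eval_opZ (r : R) p : P p -> eval_op (fun i => r%:C *: T i) p = 0.
Proof.
move=> Pp; have [k pk] := P_homogeneous Pp.
transitivity ((r ^+ k)%:C *: eval_op T p); last by rewrite TP// scaler0.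
rewrite /eval_op scaler_sumr big_seq [RHS]big_seq; apply: eq_bigr => w wp.
rewrite word_opZ ?pk//; last by move=> i; case: (bT i).
by rewrite !scalerA mulrC.
Qed.

Definition approximants (j : seq H * R) : set (kernel_family N H) :=
  [set p | almost_intertwines B T j.2 p /\
    forall x, x \in j.1 -> nsq x - j.2 <= \sum_(k < kf_size p) nsq (kf_map p k x)].

Lemma approximants_neq0 j : 0 < j.2 -> approximants j !=set0.
Proof.
(* With m = min(e, 1), the choice r = 1 - m/2 gives 1/2 <= r < 1 and 1 - r <= e. The row rT then
   satisfies the bound of [kernel_approx] with r^2. *)
case: j => s e /= e0; pose m := Num.min e 1; pose r := 1 - m / 2.
have m0 : 0 < m by rewrite lt_min e0 ltr01.
have m1 : m <= 1 by rewrite ge_min lexx orbT.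
have me : m <= e by rewrite ge_min lexx.
have r0 : 0 <= r by rewrite /r; lra.
have r1 : r < 1 by rewrite /r; lra.
have lT i : linear (T i) by case: (bT i).
pose T' i := r%:C *: T i.
have bT' i : bounded_ops H (T' i).
  by rewrite /T' -[_ *: _]addr0; apply: bounded_comb => //; exact: bounded_0.
have rr : 0 <= r ^+ 2 < 1 by rewrite sqr_ge0 expr_lt1.
have row' (t : seq (gen n)) x : uniq t ->
    \sum_(i <- t) nsq (adj (T' i) x) <= r ^+ 2 * nsq x.
  move=> ut; apply: le_trans (ler_wpM2l (sqr_ge0 r) (adj_row x ut)).
  rewrite mulr_sumr; apply: ler_sum => i _; rewrite adjZ//.
  by rewrite -[_ x]/(r%:C *: adj (T i) x) nsqZ /sqmod /= expr0n addr0.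
have [l [L [linL leL BL geL]]] := kernel_approx bT' (@eval_opZ r) rr row' s e0.
exists (KernelFamily linL leL); split=> //=.
exists r; split; [by rewrite r0 ltW|by rewrite /r; lra|].
move=> k i x; rewrite /= BL adjZ// -(op_linearZ _ _ (linL k)).
by [].
Qed.

(** Concatenating lists and taking the smaller tolerance makes the approximants a filter base; along
    a finer ultrafilter every approximate condition becomes exact. *)
Lemma poisson_exists :
  exists2 mu : (N -> N) -> H -> H, poisson_transform (range B) mu
    & forall a b : word n, mu (word_op B a \o adj (word_op B b)) =
                           word_op T a \o adj (word_op T b).
Proof.
have PF : ProperFilter (filter_from [set j | 0 < j.2] approximants).
  apply: filter_from_proper; last by move=> j; exact: approximants_neq0.
  apply: filter_from_filter; first by exists ([::], 1); exact: ltr01.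
  move=> [s d] [t e] /= d0 e0; exists (s ++ t, Num.min d e).
    by rewrite /= lt_min d0 e0.
  have md : Num.min d e <= d by rewrite ge_min lexx.
  have me : Num.min d e <= e by rewrite ge_min lexx orbT.
  move=> p [[r [r01 re rB]] ge] /=; split; split=> /=.
  - by exists r; split=> //; exact: le_trans re md.
  - move=> x xs; have := ge x; rewrite mem_cat xs => /(_ isT); apply: le_trans.
    by rewrite lerD2l lerN2.
  - by exists r; split=> //; exact: le_trans re me.
  - move=> x xs; have := ge x; rewrite mem_cat xs orbT => /(_ isT); apply: le_trans.
    by rewrite lerD2l lerN2.
have [U [UU FU]] := ultraFilterLemma PF.
have U_unital x (e : R) : 0 < e ->
    U [set p | nsq x - e <= \sum_(k < kf_size p) nsq (kf_map p k x)].
  move=> e0; apply: FU; exists ([:: x], e) => // p [_ /(_ x)] /=.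
  by rewrite inE eqxx; apply.
have U_int (e : R) : 0 < e -> U (almost_intertwines B T e).
  by move=> e0; apply: FU; exists ([::], e) => // p [].
have muw := lim_op_word (@bounded_B R n P) bT U_unital U_int.
exists (lim_op U); last exact: muw.
(* Only unital complete positivity is checked on the limit; the product rule follows from its values
   on B_a B_b^* . *)
apply: (@poisson_of_row _ _ _ P (lim_op U) _ T); last exact: muw.
have Cb := unital_sub (@Cstar_B_unital R n P).
split.
- by move=> X /Cb; exact: lim_op_bounded.
- by move=> a X Y /Cb bX /Cb bY; exact: lim_op_comb.
- exact: lim_op_id.
- by move=> m X CX; apply: lim_op_pos => i j; exact: Cb.
Qed.

End PoissonTransformExists.

Theorem theorem4p1 (R : realType) (n : option nat) (H : hilbertType R)
    (Ph : set (free_algebra R n)) (hn : n <> Some 0%N)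
    (hPh : forall p, Ph p -> homogeneous p) :
  let B := @compressed_creation R n Ph in
  (* among the unital completely positive maps on C*(B), the Poisson transforms
     are those implemented by a row contraction annihilated by Ph *)
  (forall mu : (NJ Ph -> NJ Ph) -> (H -> H),
     unital_cp_map (Cstar_algebra (range B)) mu ->
     (poisson_transform (range B) mu <->
      exists T : gen n -> H -> H,
        [/\ row_contraction T,
            forall p, Ph p -> eval_op T p = 0
          & forall a b : word n,
              mu (word_op B a \o adj (word_op B b)) =
              word_op T a \o adj (word_op T b)])) /\
  (* every such row contraction does come from a Poisson transform *)
  (forall T : gen n -> H -> H,
     row_contraction T -> (forall p, Ph p -> eval_op T p = 0) ->
     exists2 mu : (NJ Ph -> NJ Ph) -> (H -> H),
       poisson_transform (range B) mu
       & forall a b : word n,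
           mu (word_op B a \o adj (word_op B b)) =
           word_op T a \o adj (word_op T b)).
Proof.
move=> B; split=> [mu cp|T T_row TP]; last exact: poisson_exists.
split; first exact: row_of_poisson.
by move=> [T [_ _ muT]]; exact: (poisson_of_row cp (T := T)).
Qed.
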